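(* Let $d\ge2$, $c\ge0$, and let $u_{klm}$ be the Dirichlet eigenfunctions of $L$ in the unit ball $\Omega_{\mathrm{ball}}=\{x\in\mathbb{R}^d:|x|<1\}$ defined in the context. For $r>0,\epsilon>0$ let $D(r,\epsilon)=\{x\in\mathbb{R}^d:\,||x|-r|\ge\epsilon\}$. Then for every $\epsilon>0$ and every $w>0$, as $l,k\to\infty$ with $l/k\to w$ (and $m$ arbitrary with $1\le m\le\dim H_l$), $$\frac{\|u_{klm}\|_{L^\infty(D(1/h(w),\epsilon)\cap\Omega_{\mathrm{ball}})}}{\|u_{klm}\|_{L^\infty(\Omega_{\mathrm{ball}})}}\to0 .$$
   Context: $L u=-\Delta u+\frac{c^2}{|x|^2}u$ on $\mathbb{R}^d$, $d\ge2$, $c\ge0$. Set $\nu_l=\sqrt{(l+\tfrac d2-1)^2+c^2}$. $J_\nu$ is the Bessel function of the first kind of order $\nu$ and $j_{\nu,k}$ its $k$-th positive zero. $H_l$ is the space of spherical harmonics of degree $l$ on $S^{d-1}$ and $\{Y_{lm}:1\le m\le\dim H_l\}$ is an orthonormal basis of $H_l$. In spherical coordinates $x=r\xi$, $r=|x|$, $\xi\in S^{d-1}$, the Dirichlet eigenfunctions of $L$ in the unit ball are $u_{klm}(r,\xi)=r^{1-d/2}J_{\nu_l}(j_{\nu_l,k}r)Y_{lm}(\xi)$, $k\ge1$, $l\ge0$, with eigenvalues $j_{\nu_l,k}^2$. For $w>0$, $h(w)>1$ is the unique solution of $\sqrt{h^2-1}-\arccos(1/h)=\pi/w$. *)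

(* Defs.v *)
From Stdlib Require Import Reals Lra List ClassicalEpsilon.
From Stdlib Require Export Reals List Factorial.
Open Scope R_scope.

(** Points of R^d are represented as [nat -> R]; only coordinates 0..d-1 matter. *)
Definition Rvec := nat -> R.

Fixpoint sumR (n : nat) (f : nat -> R) : R :=
  match n with O => 0 | S n' => sumR n' f + f n' end.

Definition vnorm (d : nat) (x : Rvec) : R := sqrt (sumR d (fun i => (x i)^2)).

Definition vscale (a : R) (x : Rvec) : Rvec := fun i => a * x i.

(** Gamma function, via Gauss' limit formula
    Gamma(s) = lim n! n^s / (s (s+1) ... (s+n)), for s > 0. *)
Fixpoint poch_prod (s : R) (n : nat) : R :=
  match n with O => s | S n' => poch_prod s n' * (s + INR (S n')) end.

Definition Gamma_seq (s : R) (n : nat) : R :=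
  INR (fact n) * Rpower (INR n) s / poch_prod s n.

Definition Gamma (s : R) : R :=
  epsilon (inhabits 0) (fun g => Un_cv (Gamma_seq s) g).

Definition series (f : nat -> R) : R :=
  epsilon (inhabits 0) (fun l => infinite_sum f l).

(** Bessel function of the first kind of order nu >= 0, for x > 0:
    J_nu(x) = sum_m (-1)^m / (m! Gamma(m+nu+1)) (x/2)^(2m+nu). *)
Definition besselJ (nu x : R) : R :=
  Rpower (x / 2) nu *
  series (fun m => (-1)^m / (INR (fact m) * Gamma (INR m + nu + 1)) * (x / 2)^(2 * m)).

Definition is_kth_pos_zero (f : R -> R) (k : nat) (j : R) : Prop :=
  (1 <= k)%nat /\ 0 < j /\ f j = 0 /\
  exists zs : list R, length zs = (k - 1)%nat /\ NoDup zs /\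
    forall z, In z zs <-> (0 < z < j /\ f z = 0).

(** Polynomials in d variables: lists of (coefficient, exponent vector). *)
Definition poly := list (R * list nat).

Fixpoint mono_eval (x : Rvec) (i : nat) (a : list nat) : R :=
  match a with nil => 1 | e :: a' => x i ^ e * mono_eval x (S i) a' end.

Definition poly_eval (p : poly) (x : Rvec) : R :=
  fold_right (fun t acc => fst t * mono_eval x 0 (snd t) + acc) 0 p.

Fixpoint upd_sub2 (a : list nat) (i : nat) : list nat :=
  match a, i with
  | nil, _ => nil
  | e :: a', O => (e - 2)%nat :: a'
  | e :: a', S i' => e :: upd_sub2 a' i'
  end.

(** Laplacian of a polynomial, evaluated at x:
    sum_i sum_terms c * a_i (a_i - 1) * x^(a - 2 e_i). *)
Definition lap_eval (d : nat) (p : poly) (x : Rvec) : R :=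
  sumR d (fun i =>
    fold_right (fun t acc =>
      fst t * INR (nth i (snd t) 0%nat * (nth i (snd t) 0%nat - 1))
            * mono_eval x 0 (upd_sub2 (snd t) i) + acc) 0 p).

Definition is_hhp (d l : nat) (p : poly) : Prop :=
  Forall (fun t => length (snd t) = d /\ fold_right Nat.add 0%nat (snd t) = l) p /\
  forall x, lap_eval d p x = 0.

Definition spherical_harmonic (d l : nat) (Y : Rvec -> R) : Prop :=
  exists p, is_hhp d l p /\ forall x, vnorm d x = 1 -> Y x = poly_eval p x.

Definition nu (d : nat) (c : R) (l : nat) : R :=
  sqrt ((INR l + INR d / 2 - 1)^2 + c^2).

Definition u_eig (d : nat) (c : R) (l : nat) (j : R) (Y : Rvec -> R) (x : Rvec) : R :=
  Rpower (vnorm d x) (1 - INR d / 2) * besselJ (nu d c l) (j * vnorm d x)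
  * Y (vscale (/ vnorm d x) x).

(** Supremum of |f| over S (sup of the empty set is 0). *)
Definition sup_abs (S : Rvec -> Prop) (f : Rvec -> R) : R :=
  epsilon (inhabits 0)
    (fun M => is_lub (fun y => y = 0 \/ exists x, S x /\ y = Rabs (f x)) M).

(** Punctured unit ball (the origin is a null set). *)
Definition ball_set (d : nat) : Rvec -> Prop := fun x => 0 < vnorm d x < 1.

Definition D_ball (d : nat) (r eps : R) : Rvec -> Prop :=
  fun x => ball_set d x /\ Rabs (vnorm d x - r) >= eps.

Definition nat_to_infty (s : nat -> nat) : Prop :=
  forall M : nat, exists N, forall n, (N <= n)%nat -> (M <= s n)%nat.

(* Main.v *)
Require Import Defs.
From Stdlib Require Import ZArith Reals Ranalysis5 Lra Lia List.
From Stdlib Require Import ClassicalEpsilon FunctionalExtensionality.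
From Coquelicot Require Import Coquelicot.
Open Scope R_scope.

(** With [x = nu e^t], [g(t) = J_nu(nu e^t)] solves [g'' + nu^2 q g = 0], [q = e^(2t) - 1],
    with [g, g' -> 0] at [-oo]; the turning point is [t = 0].

    Zeros: Sturm comparison with the WKB functions [q^(-1/4) sin(nu Theta + c)],
    [Theta = v - atan v], [v = sqrt q], shows that [Theta] advances by at most [pi / nu]
    between zeros of [g], and a slightly shifted [Theta] by at least [pi / nu]. Counting zeros
    gives [Theta(ln(j_{nu,k} / nu)) ~ pi k / nu], i.e. [j_{nu,k} / nu -> h(w)], so that
    [t = 0] corresponds to the radius [1 / h(w)] in the limit.

    Amplitude: for [t < 0] the energy [g'^2 + nu^2 q g^2] increases from [0], hence
    [g' / g >= nu sqrt(1 - e^(2t))] and [g] decays exponentially to the left of the turning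
    point. For [t > 0] the adiabatic invariant [nu^2 v g^2 + g'^2 / v] is constant up to a
    bounded factor, so [g^2] at distance [delta] is [O(v(t1) / v(delta))] times [g(t1)^2] at a
    critical point [t1] which can be taken arbitrarily close to [0]. Since the eigenfunctions
    separate, both comparisons take place along a fixed ray. *)

(** * Gamma function and power series of [J_nu] *)

(** The WKB error [q^(1/4) (q^(-1/4))''] is positive but blows up like [t^(-2)] at the turning
    point. Its sign makes one Sturm inequality free: WKB functions of frequency at most [nu]
    oscillate more slowly than [g]. The reverse inequality fails near [t = 0] and is bought by a
    shift [rho > 0], which stays fixed while [nu] grows and only has to be smaller than the
    deviation of [ln (j / nu)] that is being excluded. To the right of the turning point the
    reference point [t1] is a critical point because there the invariant reduces to [nu^2 v g^2], so
    it bounds [|g|] elsewhere by [|g(t1)|]. Two zeros close to [0] and Rolle's theorem provide it.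
    As [v(t1)] tends to [0] with [t1], any constant lost in the invariant is absorbed, and no Airy
    asymptotics enter. The ratio of suprema is bounded pointwise: every point of the excluded region
    is dominated by a point of the ball on the same ray. The angular factor is then common to both
    sides, and neither norm has to be estimated. *)

Lemma poch_prod_pos (s : R) (n : nat) : 0 < s -> 0 < poch_prod s n.
Proof.
  intros hs; induction n as [|n IH]; cbn [poch_prod]; [exact hs|].
  apply Rmult_lt_0_compat; [exact IH|]. pose proof (pos_INR (S n)); lra.
Qed.

Lemma poch_prod_shift (s : R) (n : nat) :
  s * poch_prod (s + 1) n = poch_prod s n * (s + INR n + 1).
Proof.
  induction n as [|n IH]; cbn [poch_prod].
  - simpl; ring.
  - rewrite <- Rmult_assoc, IH, S_INR; ring.
Qed.

Lemma Gamma_seq_pos (s : R) (n : nat) : 0 < s -> 0 < Gamma_seq s n.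
Proof.
  intros hs; unfold Gamma_seq.
  apply Rdiv_lt_0_compat; [|apply poch_prod_pos, hs].
  apply Rmult_lt_0_compat; [apply INR_fact_lt_0|apply exp_pos].
Qed.

(** The quotient of consecutive terms is at least 1 exactly when [(1 + 1/N)^s >= 1 + s/(N+1)], which
    follows from [ln (N+1) - ln N >= 1/(N+1)]. Indices start at 1 because at 0 the power rests on
    the default value of [ln 0]. *)
Lemma Gamma_seq_incr (s : R) (n : nat) :
  0 < s -> Gamma_seq s (S n) <= Gamma_seq s (S (S n)).
Proof.
  intros hs; unfold Gamma_seq.
  set (N := INR (S n)).
  assert (hN : 0 < N) by (apply lt_0_INR; lia).
  assert (hp := poch_prod_pos s (S n) hs).
  change (poch_prod s (S (S n))) with (poch_prod s (S n) * (s + INR (S (S n)))).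
  rewrite (fact_simpl (S n)), mult_INR, (S_INR (S n)). fold N.
  assert (hf := INR_fact_lt_0 (S n)).
  assert (hl : / (N + 1) <= ln (N + 1) - ln N).
  { assert (h1 : ln (N / (N + 1)) <= N / (N + 1) - 1).
    { rewrite <- (ln_exp (N / (N + 1) - 1)).
      apply ln_le; [apply Rdiv_lt_0_compat; lra|].
      pose proof (exp_ineq1_le (N / (N + 1) - 1)); lra. }
    rewrite ln_div in h1 by lra.
    replace (N / (N + 1) - 1) with (- / (N + 1)) in h1 by (field; lra). lra. }
  assert (hR : Rpower (N + 1) s >= Rpower N s * (1 + s / (N + 1))).
  { replace (Rpower (N + 1) s) with (Rpower N s * exp (s * (ln (N + 1) - ln N))).
    2:{ unfold Rpower; rewrite <- exp_plus; f_equal; ring. }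
    apply Rle_ge, Rmult_le_compat_l; [left; apply exp_pos|].
    eapply Rle_trans; [|apply exp_ineq1_le].
    apply Rplus_le_compat_l; unfold Rdiv; apply Rmult_le_compat_l; lra. }
  apply Rmult_le_reg_r with (poch_prod s (S n) * (s + (N + 1))).
  { apply Rmult_lt_0_compat; lra. }
  field_simplify; [|lra|lra].
  apply Rge_le in hR.
  apply Rmult_le_compat_l with (r := INR (fact (S n)) * (N + 1)) in hR.
  2:{ apply Rmult_le_pos; lra. }
  replace (INR (fact (S n)) * (N + 1) * (Rpower N s * (1 + s / (N + 1)))) with
    (INR (fact (S n)) * Rpower N s * (N + 1 + s)) in hR by (field; lra).
  lra.
Qed.

(** Add [h1] with weight [s] and [h2] with weight [1 - s]: the terms linear in [L] cancel. *)
Lemma Rpower_bernoulli (s y : R) :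
  0 <= s <= 1 -> 0 < 1 + y -> Rpower (1 + y) s <= 1 + s * y.
Proof.
  intros hs hy; unfold Rpower. set (L := ln (1 + y)).
  assert (hL : exp L = 1 + y) by (apply exp_ln, hy).
  assert (h1 : exp (s * L) * (1 + (1 - s) * L) <= exp L).
  { replace (exp L) with (exp (s * L) * exp ((1 - s) * L))
      by (rewrite <- exp_plus; f_equal; ring).
    apply Rmult_le_compat_l; [left; apply exp_pos|apply exp_ineq1_le]. }
  assert (h2 : exp (s * L) * (1 + - (s * L)) <= 1).
  { apply Rle_trans with (exp (s * L) * exp (- (s * L))).
    2:{ rewrite <- exp_plus, Rplus_opp_r, exp_0; lra. }
    apply Rmult_le_compat_l; [left; apply exp_pos|apply exp_ineq1_le]. }
  pose proof (exp_pos (s * L)). nra.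
Qed.

(** Replacing [N^s] by [(N+1)^s] enlarges the terms, and the enlarged sequence starts at [1/s] and
    is nonincreasing by Bernoulli's inequality. *)
Lemma Gamma_seq_bound (s : R) (n : nat) : 0 < s <= 1 -> Gamma_seq s (S n) <= / s.
Proof.
  intros hs.
  apply Rle_trans with (INR (fact (S n)) * Rpower (INR (S n) + 1) s / poch_prod s (S n)).
  { unfold Gamma_seq, Rdiv; apply Rmult_le_compat_r.
    { left; apply Rinv_0_lt_compat, poch_prod_pos; lra. }
    apply Rmult_le_compat_l; [left; apply INR_fact_lt_0|].
    apply Rle_Rpower_l; [lra|]. assert (0 < INR (S n)) by (apply lt_0_INR; lia); lra. }
  generalize (S n); clear n; intros n; induction n as [|n IH].
  { simpl. unfold Rpower; rewrite Rplus_0_l, ln_1, Rmult_0_r, exp_0.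
    right; field; lra. }
  eapply Rle_trans; [|exact IH].
  change (poch_prod s (S n)) with (poch_prod s n * (s + INR (S n))).
  assert (hp := poch_prod_pos s n (proj1 hs)).
  rewrite fact_simpl, mult_INR. rewrite <- (S_INR n).
  set (N := INR (S n)).
  assert (hN : 0 < N) by (apply lt_0_INR; lia).
  assert (hB := Rpower_bernoulli s (/ N)).
  assert (hiN := Rinv_0_lt_compat _ hN).
  assert (e : Rpower (N + 1) s = Rpower N s * Rpower (1 + / N) s).
  { rewrite Rpower_mult_distr by lra. f_equal; field; lra. }
  rewrite e.
  apply Rmult_le_reg_r with (poch_prod s n * (s + N)); [apply Rmult_lt_0_compat; lra|].
  field_simplify; [|lra|lra].
  specialize (hB ltac:(lra) ltac:(lra)).
  apply Rmult_le_compat_l with (r := INR (fact n) * (Rpower N s * N)) in hB.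
  2:{ apply Rmult_le_pos; [left; apply INR_fact_lt_0|].
      apply Rmult_le_pos; [left; apply exp_pos|lra]. }
  replace (INR (fact n) * (Rpower N s * N) * (1 + s * / N)) with
    (INR (fact n) * Rpower N s * (N + s)) in hB by (field; lra).
  lra.
Qed.

Lemma Gamma_seq_shift (s : R) (n : nat) : 0 < s ->
  Gamma_seq (s + 1) (S n) = Gamma_seq s (S n) * (s * (INR (S n) / (INR (S n) + (s + 1)))).
Proof.
  intros hs; unfold Gamma_seq.
  assert (hN : 0 < INR (S n)) by (apply lt_0_INR; lia).
  assert (hp := poch_prod_pos s (S n) hs).
  assert (hp1 := poch_prod_pos (s + 1) (S n) ltac:(lra)).
  assert (e := poch_prod_shift s (S n)).
  rewrite Rpower_plus, Rpower_1 by lra.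
  replace (poch_prod (s + 1) (S n)) with (poch_prod s (S n) * (s + INR (S n) + 1) / s)
    by (rewrite <- e; field; lra).
  field; lra.
Qed.

Lemma is_lim_seq_ratio_shift (s : R) :
  0 < s -> is_lim_seq (fun n => INR (S n) / (INR (S n) + s)) 1.
Proof.
  intros hs.
  apply is_lim_seq_ext with (fun n => 1 - s * / (INR (S n) + s)).
  { intros n. assert (0 < INR (S n)) by (apply lt_0_INR; lia). field; lra. }
  replace (Finite 1) with (Rbar_minus 1 (Rbar_mult s 0)) by (simpl; f_equal; ring).
  apply is_lim_seq_minus'; [apply is_lim_seq_const|].
  apply (is_lim_seq_scal_l _ s 0).
  replace (Finite 0) with (Rbar_inv p_infty) by reflexivity.
  apply is_lim_seq_inv; [|discriminate].
  apply is_lim_seq_plus with p_infty s; [|apply is_lim_seq_const|reflexivity].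
  apply -> is_lim_seq_incr_1. apply is_lim_seq_INR.
Qed.

(** Monotone convergence settles [(0, 1]], and the shift relation carries the limit to each further
    unit interval. Existence of the limit is what gives the [epsilon] in [Gamma] its meaning. *)
Lemma Gamma_seq_cv (s : R) : 0 < s ->
  exists g, 0 < g /\ is_lim_seq (fun n => Gamma_seq s (S n)) g.
Proof.
  assert (base : forall s, 0 < s <= 1 ->
    exists g, 0 < g /\ is_lim_seq (fun n => Gamma_seq s (S n)) g).
  { clear s; intros s hs.
    assert (hi : forall n, Gamma_seq s (S n) <= Gamma_seq s (S (S n)))
      by (intros; apply Gamma_seq_incr; lra).
    destruct (ex_finite_lim_seq_incr (fun n => Gamma_seq s (S n)) (/ s) hi) as [g hg].
    { intros n; apply Gamma_seq_bound, hs. }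
    exists g; split; [|exact hg].
    apply Rlt_le_trans with (Gamma_seq s 1); [apply Gamma_seq_pos; lra|].
    exact (is_lim_seq_incr_compare _ g hg hi 0). }
  assert (step : forall p s, 0 < s <= INR p + 1 ->
    exists g, 0 < g /\ is_lim_seq (fun n => Gamma_seq s (S n)) g).
  { intros p; induction p as [|p IH]; intros s' hs'.
    { apply base; simpl in hs'; lra. }
    rewrite S_INR in hs'.
    destruct (Rle_dec s' 1) as [h1|h1]; [apply base; lra|].
    destruct (IH (s' - 1)) as [g [hg lg]]; [lra|].
    exists (g * ((s' - 1) * 1)); split; [apply Rmult_lt_0_compat; lra|].
    apply is_lim_seq_ext with
      (fun n => Gamma_seq (s' - 1) (S n) * ((s' - 1) * (INR (S n) / (INR (S n) + s')))).
    { intros n. replace s' with (s' - 1 + 1) at 4 by ring.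
      rewrite Gamma_seq_shift by lra. replace (s' - 1 + 1) with s' by ring. reflexivity. }
    apply is_lim_seq_mult'; [exact lg|].
    apply is_lim_seq_mult'; [apply is_lim_seq_const|].
    apply is_lim_seq_ratio_shift; lra. }
  intros hs. destruct (nfloor_ex s) as [p hp]; [lra|].
  apply (step p); lra.
Qed.

Lemma Gamma_spec (s : R) : 0 < s ->
  0 < Gamma s /\ is_lim_seq (fun n => Gamma_seq s (S n)) (Gamma s).
Proof.
  intros hs. destruct (Gamma_seq_cv s hs) as [g [hg lg]].
  assert (hex : exists g, Un_cv (Gamma_seq s) g).
  { exists g. apply is_lim_seq_Reals, is_lim_seq_incr_1, lg. }
  assert (h : Un_cv (Gamma_seq s) (Gamma s)) by exact (epsilon_spec (inhabits 0) _ hex).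
  apply is_lim_seq_Reals, is_lim_seq_incr_1 in h.
  split; [|exact h].
  apply is_lim_seq_unique in h. apply is_lim_seq_unique in lg.
  rewrite h in lg. injection lg; intros ->; exact hg.
Qed.

Lemma Gamma_succ (s : R) : 0 < s -> Gamma (s + 1) = s * Gamma s.
Proof.
  intros hs.
  destruct (Gamma_spec (s + 1)) as [_ h1]; [lra|].
  destruct (Gamma_spec s hs) as [_ h0].
  assert (h2 : is_lim_seq (fun n => Gamma_seq (s + 1) (S n)) (Gamma s * (s * 1))).
  { eapply is_lim_seq_ext.
    { intros n; symmetry; apply Gamma_seq_shift, hs. }
    apply is_lim_seq_mult'; [exact h0|].
    apply is_lim_seq_mult'; [apply is_lim_seq_const|].
    apply is_lim_seq_ratio_shift; lra. }
  apply is_lim_seq_unique in h1. apply is_lim_seq_unique in h2.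
  rewrite h1 in h2. injection h2; intros ->; ring.
Qed.

Definition bessel_coef (nu : R) (m : nat) : R :=
  (-1) ^ m / (INR (fact m) * Gamma (INR m + nu + 1)).

Lemma bessel_coef_neq0 (nu : R) (m : nat) : 0 <= nu -> bessel_coef nu m <> 0.
Proof.
  intros hn; unfold bessel_coef, Rdiv. pose proof (pos_INR m).
  apply Rmult_integral_contrapositive; split; [apply pow_nonzero; lra|].
  apply Rinv_neq_0_compat, Rmult_integral_contrapositive; split; [apply INR_fact_neq_0|].
  apply Rgt_not_eq, Gamma_spec; lra.
Qed.

Lemma bessel_coef_succ (nu : R) (m : nat) : 0 <= nu ->
  bessel_coef nu (S m) * (INR (S m) * (INR (S m) + nu)) = - bessel_coef nu m.
Proof.
  intros hn; unfold bessel_coef. pose proof (pos_INR m).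
  rewrite S_INR.
  replace (INR m + 1 + nu + 1) with ((INR m + nu + 1) + 1) by ring.
  rewrite Gamma_succ by lra.
  rewrite fact_simpl, mult_INR, S_INR. rewrite <- tech_pow_Rmult.
  pose proof (INR_fact_lt_0 m).
  destruct (Gamma_spec (INR m + nu + 1)) as [hg _]; [lra|].
  field; repeat split; lra.
Qed.

Lemma bessel_coef_radius (nu : R) : 0 <= nu -> CV_radius (bessel_coef nu) = p_infty.
Proof.
  intros hn. apply CV_radius_infinite_DAlembert.
  { intros m; apply bessel_coef_neq0, hn. }
  apply is_lim_seq_le_le with (fun _ => 0) (fun n => / INR (S n)).
  - intros n. split; [apply Rabs_pos|].
    assert (hN : 0 < INR (S n)) by (apply lt_0_INR; lia).
    assert (h1 : 1 <= INR (S n)) by (rewrite S_INR; pose proof (pos_INR n); lra).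
    replace (bessel_coef nu (S n) / bessel_coef nu n)
      with (- / (INR (S n) * (INR (S n) + nu))).
    2:{ assert (e := bessel_coef_succ nu n hn).
        assert (h := bessel_coef_neq0 nu n hn).
        apply Rmult_eq_reg_r with (bessel_coef nu n * (INR (S n) * (INR (S n) + nu))).
        2:{ apply Rmult_integral_contrapositive; split; [exact h|].
            apply Rgt_not_eq, Rmult_lt_0_compat; lra. }
        transitivity (- bessel_coef nu n); [field; lra|]. rewrite <- e; field; exact h. }
    rewrite Rabs_Ropp, Rabs_pos_eq.
    2:{ left; apply Rinv_0_lt_compat, Rmult_lt_0_compat; lra. }
    apply Rinv_le_contravar; [exact hN|]. nra.
  - apply is_lim_seq_const.
  - replace (Finite 0) with (Rbar_inv p_infty) by reflexivity.
    apply is_lim_seq_inv; [|discriminate].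
    apply -> is_lim_seq_incr_1. apply is_lim_seq_INR.
Qed.

Lemma besselJ_PSeries (nu x : R) : 0 <= nu ->
  besselJ nu x = Rpower (x / 2) nu * PSeries (bessel_coef nu) ((x / 2) ^ 2).
Proof.
  intros hn; unfold besselJ; f_equal.
  set (f := fun m => _).
  assert (hs : is_series f (PSeries (bessel_coef nu) ((x / 2) ^ 2))).
  { assert (h : is_pseries (bessel_coef nu) ((x / 2) ^ 2)
                  (PSeries (bessel_coef nu) ((x / 2) ^ 2))).
    { apply PSeries_correct, CV_radius_inside. rewrite bessel_coef_radius by exact hn. exact I. }
    apply is_pseries_R in h.
    eapply is_series_ext; [|exact h].
    intros m; unfold f, bessel_coef; cbv beta. rewrite pow_mult. reflexivity. }
  assert (hex : exists l, infinite_sum f l).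
  { eexists; apply is_series_Reals, hs. }
  assert (h : infinite_sum f (series f)) by exact (epsilon_spec (inhabits 0) _ hex).
  apply is_series_Reals in h.
  apply is_series_unique in h. apply is_series_unique in hs. congruence.
Qed.

(** * The Bessel equation in logarithmic variable *)

(** The coefficient of [z^m] on the left is [(m+1)(m+1+nu) a_(m+1) + a_m], zero by the
    recurrence. *)
Lemma bessel_PSeries_ode (nu z : R) : 0 <= nu ->
  z * PSeries (PS_derive (PS_derive (bessel_coef nu))) z
  + (nu + 1) * PSeries (PS_derive (bessel_coef nu)) z + PSeries (bessel_coef nu) z = 0.
Proof.
  intros hn. set (a := bessel_coef nu).
  assert (h0 : ex_pseries a z).
  { apply CV_radius_inside. unfold a; rewrite bessel_coef_radius by exact hn; exact I. }
  assert (h1 : ex_pseries (PS_derive a) z).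
  { apply CV_radius_inside. rewrite CV_radius_derive.
    unfold a; rewrite bessel_coef_radius by exact hn; exact I. }
  assert (h2 : ex_pseries (PS_derive (PS_derive a)) z).
  { apply CV_radius_inside. rewrite !CV_radius_derive.
    unfold a; rewrite bessel_coef_radius by exact hn; exact I. }
  rewrite <- PSeries_incr_1, <- PSeries_scal.
  rewrite <- PSeries_plus.
  2:{ apply ex_pseries_incr_1, h2. }
  2:{ apply ex_pseries_scal; [apply Rmult_comm|exact h1]. }
  rewrite <- PSeries_plus.
  2:{ apply ex_pseries_plus; [apply ex_pseries_incr_1, h2|].
      apply ex_pseries_scal; [apply Rmult_comm|exact h1]. }
  2:exact h0.
  rewrite <- (PSeries_const_0 z).
  apply PSeries_ext; intros [|m]; unfold PS_plus, PS_scal, PS_incr_1, PS_derive;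
    unfold plus, scal, zero; simpl AbelianMonoid.plus; unfold mult; simpl.
  - assert (e := bessel_coef_succ nu 0 hn). fold a in e. simpl in e. lra.
  - assert (e := bessel_coef_succ nu (S m) hn). fold a in e.
    rewrite !S_INR in e. change (match m with O => 1 | S _ => INR m + 1 end) with (INR (S m)).
    rewrite !S_INR. lra.
Qed.

(** Interface between the power series and the analysis: the estimates below hold for every such
    [g]. [ode_lim] selects the solution that is recessive at [-oo], and [ode_neq0] excludes the zero
    solution in the form used by the energy argument. *)
Record bessel_ode (nu : R) (g g1 : R -> R) : Prop := {
  ode_order : 0 < nu;
  ode_derive : forall t, is_derive g t (g1 t);
  ode_derive1 : forall t, is_derive g1 t (nu ^ 2 * (1 - exp (2 * t)) * g t);
  ode_lim : forall e, 0 < e ->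
    exists T, forall t, t <= T -> Rabs (g t) <= e /\ Rabs (g1 t) <= e;
  ode_neq0 : forall T, exists t, t <= T /\ g t <> 0 }.

Lemma exp_le_compat (x y : R) : x <= y -> exp x <= exp y.
Proof. intros [h|<-]; [left; apply exp_increasing, h|apply Rle_refl]. Qed.

Lemma exp_eventually_small (C c e : R) : 0 < C -> 0 < c -> 0 < e ->
  exists T, forall t, t <= T -> C * exp (c * t) <= e.
Proof.
  intros hC hc he. exists (ln (e / C) / c); intros t ht.
  assert (hq : 0 < e / C) by (apply Rdiv_lt_0_compat; lra).
  assert (h : exp (c * t) <= e / C).
  { rewrite <- (exp_ln (e / C)) by exact hq. apply exp_le_compat.
    apply Rmult_le_compat_l with (r := c) in ht; [|lra].
    replace (c * (ln (e / C) / c)) with (ln (e / C)) in ht by (field; lra). exact ht. }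
  apply Rmult_le_compat_l with (r := C) in h; [|lra].
  replace (C * (e / C)) with e in h by (field; lra). exact h.
Qed.

Lemma besselJ_exp (nu t : R) : 0 < nu ->
  besselJ nu (nu * exp t) =
  exp (nu * (ln (nu / 2) + t)) * PSeries (bessel_coef nu) (nu ^ 2 / 4 * exp (2 * t)).
Proof.
  intros hn. rewrite besselJ_PSeries by lra. f_equal.
  - unfold Rpower. f_equal; f_equal.
    replace (nu * exp t / 2) with (nu / 2 * exp t) by field.
    rewrite ln_mult, ln_exp; [ring|lra|apply exp_pos].
  - f_equal. replace (2 * t) with (t + t) by ring. rewrite exp_plus. field.
Qed.

Lemma besselJ_bessel_ode (nu : R) : 0 < nu ->
  exists g1, bessel_ode nu (fun t => besselJ nu (nu * exp t)) g1.
Proof.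
  intros hn.
  set (a := bessel_coef nu).
  set (P := PSeries a). set (P1 := PSeries (PS_derive a)).
  set (P2 := PSeries (PS_derive (PS_derive a))).
  assert (ha : CV_radius a = p_infty) by (apply bessel_coef_radius; lra).
  assert (dP : forall z, is_derive P z (P1 z)).
  { intros z; apply is_derive_PSeries. rewrite ha; exact I. }
  assert (dP1 : forall z, is_derive P1 z (P2 z)).
  { intros z; apply is_derive_PSeries. rewrite CV_radius_derive, ha; exact I. }
  assert (uP : forall z, Derive (fun x => P x) z = P1 z)
    by (intros z; apply is_derive_unique, dP).
  assert (uP1 : forall z, Derive (fun x => P1 x) z = P2 z)
    by (intros z; apply is_derive_unique, dP1).
  assert (ode : forall z, z * P2 z + (nu + 1) * P1 z + P z = 0).
  { intros z; apply bessel_PSeries_ode; lra. }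
  assert (hP0 : P 0 <> 0).
  { unfold P; rewrite PSeries_0; apply bessel_coef_neq0; lra. }
  set (K := nu ^ 2 / 4). assert (hK : 0 < K) by (unfold K; nra).
  set (L := ln (nu / 2)).
  set (z := fun t => K * exp (2 * t)).
  set (w := fun t => exp (nu * (L + t))).
  set (g1 := fun t => w t * (nu * P (z t) + 2 * z t * P1 (z t))).
  assert (hg : forall t, besselJ nu (nu * exp t) = w t * P (z t)).
  { intros t; apply besselJ_exp, hn. }
  (* [z t] tends to [0] at [-oo], so [P] and [P1] approach their values at [0]: they stay bounded,
     which leaves the decay to [w], and [P] does not vanish far to the left. *)
  assert (cont : forall (F F1 : R -> R), (forall z, is_derive F z (F1 z)) ->
    forall e, 0 < e -> exists T, forall t, t <= T -> Rabs (F (z t) - F 0) < e).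
  { intros F F1 hF e he.
    assert (hc : continuity_pt F 0).
    { apply derivable_continuous_pt. exists (F1 0). apply is_derive_Reals, hF. }
    destruct (hc e he) as [d [hd hd']].
    destruct (exp_eventually_small K 2 (d / 2)) as [T hT]; try lra.
    exists T; intros t ht. apply hd'. split.
    - split; [exact I|]. apply Rlt_not_eq. apply Rmult_lt_0_compat; [lra|apply exp_pos].
    - simpl; unfold R_dist. rewrite Rminus_0_r, Rabs_pos_eq.
      + specialize (hT t ht). unfold z; lra.
      + left; apply Rmult_lt_0_compat; [lra|apply exp_pos]. }
  destruct (cont P P1 dP 1) as [Ta hTa]; [lra|].
  destruct (cont P1 P2 dP1 1) as [Tb hTb]; [lra|].
  exists g1; split.
  - exact hn.
  - intros t. apply is_derive_ext with (fun t => w t * P (z t)).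
    { intros s; symmetry; apply hg. }
    unfold w, z. auto_derive.
    + repeat split. exists (P1 (K * exp (2 * t))); apply dP.
    + rewrite (uP (K * exp (2 * t))). unfold g1, w, z. ring.
  - intros t. rewrite hg. unfold g1, w, z. auto_derive.
    + repeat split; [exists (P1 (K * exp (2 * t))); apply dP
                    |exists (P2 (K * exp (2 * t))); apply dP1].
    + rewrite (uP (K * exp (2 * t))).
      rewrite (uP1 (K * exp (2 * t))).
      assert (e := ode (K * exp (2 * t))). set (E := exp (2 * t)) in *.
      replace (nu ^ 2 * (1 - E) * (exp (nu * (L + t)) * P (K * E)))
        with (exp (nu * (L + t)) * (nu ^ 2 * P (K * E) - 4 * (K * E) * P (K * E)))
        by (unfold K; field).
      replace (P (K * E)) with (- (K * E * P2 (K * E) + (nu + 1) * P1 (K * E))) by lra.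
      ring.
  - intros e he.
    set (B := Rabs (P 0) + 1). set (B1 := Rabs (P1 0) + 1).
    assert (hB : 0 < B) by (unfold B; pose proof (Rabs_pos (P 0)); lra).
    assert (hB1 : 0 < B1) by (unfold B1; pose proof (Rabs_pos (P1 0)); lra).
    destruct (exp_eventually_small K 2 1) as [Tc hTc]; try lra.
    set (M := B + nu * B + 2 * B1).
    assert (hM : 0 < M) by (unfold M; nra).
    destruct (exp_eventually_small (exp (nu * L) * M) nu e) as [Td hTd]; try lra.
    { apply Rmult_lt_0_compat; [apply exp_pos|lra]. }
    exists (Rmin (Rmin Ta Tb) (Rmin Tc Td)); intros t ht.
    assert (ht1 := Rle_trans _ _ _ ht (Rmin_l _ _)).
    assert (ht2 := Rle_trans _ _ _ ht (Rmin_r _ _)).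
    assert (hta := hTa t (Rle_trans _ _ _ ht1 (Rmin_l _ _))).
    assert (htb := hTb t (Rle_trans _ _ _ ht1 (Rmin_r _ _))).
    assert (htc := hTc t (Rle_trans _ _ _ ht2 (Rmin_l _ _))).
    assert (htd := hTd t (Rle_trans _ _ _ ht2 (Rmin_r _ _))).
    fold (z t) in htc.
    assert (hz : 0 < z t) by (apply Rmult_lt_0_compat; [lra|apply exp_pos]).
    assert (hw : 0 < w t) by apply exp_pos.
    assert (hPz : Rabs (P (z t)) <= B).
    { unfold B. replace (P (z t)) with (P 0 + (P (z t) - P 0)) by ring.
      eapply Rle_trans; [apply Rabs_triang|]. lra. }
    assert (hP1z : Rabs (P1 (z t)) <= B1).
    { unfold B1. replace (P1 (z t)) with (P1 0 + (P1 (z t) - P1 0)) by ring.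
      eapply Rle_trans; [apply Rabs_triang|]. lra. }
    assert (hwM : w t * M <= e).
    { eapply Rle_trans; [|exact htd]. right. unfold w.
      rewrite Rmult_plus_distr_l, exp_plus. ring. }
    split.
    + rewrite hg, Rabs_mult, (Rabs_pos_eq (w t)) by lra.
      eapply Rle_trans; [|exact hwM]. apply Rmult_le_compat_l; [lra|].
      unfold M; nra.
    + unfold g1; rewrite Rabs_mult, (Rabs_pos_eq (w t)) by lra.
      eapply Rle_trans; [|exact hwM]. apply Rmult_le_compat_l; [lra|].
      eapply Rle_trans; [apply Rabs_triang|].
      rewrite !Rabs_mult, (Rabs_pos_eq nu), (Rabs_pos_eq 2), (Rabs_pos_eq (z t)) by lra.
      assert (z t * Rabs (P1 (z t)) <= 1 * B1).
      { apply Rmult_le_compat; try lra. apply Rabs_pos. }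
      unfold M; nra.
  - intros T.
    destruct (cont P P1 dP (Rabs (P 0))) as [Te hTe]; [apply Rabs_pos_lt, hP0|].
    exists (Rmin T Te); split; [apply Rmin_l|].
    rewrite hg. apply Rmult_integral_contrapositive; split.
    + apply Rgt_not_eq, exp_pos.
    + intros h. specialize (hTe _ (Rmin_r T Te)). rewrite h in hTe.
      rewrite Rminus_0_l, Rabs_Ropp in hTe. lra.
Qed.

(** * Energy estimates *)

Lemma is_derive_continuity_pt (f : R -> R) (x l : R) : is_derive f x l -> continuity_pt f x.
Proof.
  intros h. apply derivable_continuous_pt. exists l. apply is_derive_Reals, h.
Qed.

Lemma is_derive_MVT (f df : R -> R) (a b : R) : a < b ->
  (forall t, a <= t <= b -> is_derive f t (df t)) ->
  exists c, a <= c <= b /\ f b - f a = df c * (b - a).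
Proof.
  intros hab hd.
  destruct (MVT_gen f a b df) as [c [hc e]].
  - intros x; rewrite Rmin_left, Rmax_right by lra; intros hx; apply hd; lra.
  - intros x; rewrite Rmin_left, Rmax_right by lra; intros hx.
    apply is_derive_continuity_pt with (df x), hd; lra.
  - rewrite Rmin_left, Rmax_right in hc by lra. exists c; split; assumption.
Qed.

Lemma is_derive_incr (f df : R -> R) (a b : R) : a <= b ->
  (forall t, a <= t <= b -> is_derive f t (df t)) ->
  (forall t, a <= t <= b -> 0 <= df t) -> f a <= f b.
Proof.
  intros [hab| ->] hd hp; [|apply Rle_refl].
  destruct (is_derive_MVT f df a b hab hd) as [c [hc e]].
  specialize (hp c hc). nra.
Qed.

Lemma is_derive_decr (f df : R -> R) (a b : R) : a <= b ->
  (forall t, a <= t <= b -> is_derive f t (df t)) ->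
  (forall t, a <= t <= b -> df t <= 0) -> f b <= f a.
Proof.
  intros [hab| ->] hd hp; [|apply Rle_refl].
  destruct (is_derive_MVT f df a b hab hd) as [c [hc e]].
  specialize (hp c hc). nra.
Qed.

(** Stands in for integration from [-oo]: by monotonicity a negative value would bound [f] away from
    [0] on the whole left half-line. *)
Lemma incr_nonneg (f df : R -> R) (b : R) :
  (forall t, t <= b -> is_derive f t (df t)) ->
  (forall t, t <= b -> 0 <= df t) ->
  (forall e, 0 < e -> exists T, forall t, t <= T -> - e <= f t) ->
  forall t, t <= b -> 0 <= f t.
Proof.
  intros hd hp hl t ht.
  destruct (Rle_dec 0 (f t)) as [h|h]; [exact h|exfalso].
  destruct (hl (- f t / 2)) as [T hT]; [lra|].
  specialize (hT (Rmin T t) (Rmin_l _ _)).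
  assert (hm := Rmin_r T t).
  assert (f (Rmin T t) <= f t).
  { apply is_derive_incr with df; [lra|intros s hs; apply hd; lra|intros s hs; apply hp; lra]. }
  lra.
Qed.

Section Energy.
Variables (nu : R) (g g1 : R -> R).
Hypothesis ode : bessel_ode nu g g1.

Let hnu : 0 < nu := ode_order _ _ _ ode.
Let dg := ode_derive _ _ _ ode.
Let dg1 := ode_derive1 _ _ _ ode.

Let ug (t : R) : Derive (fun x => g x) t = g1 t.
Proof. apply is_derive_unique, dg. Qed.

Let ug1 (t : R) : Derive (fun x => g1 x) t = nu ^ 2 * (1 - exp (2 * t)) * g t.
Proof. apply is_derive_unique, dg1. Qed.

Let eg (t : R) : ex_derive (fun x => g x) t.
Proof. eexists; apply dg. Qed.

Let eg1 (t : R) : ex_derive (fun x => g1 x) t.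
Proof. eexists; apply dg1. Qed.

Definition bessel_energy (t : R) : R := g1 t ^ 2 - nu ^ 2 * (1 - exp (2 * t)) * g t ^ 2.

Lemma is_derive_bessel_energy (t : R) :
  is_derive bessel_energy t (2 * nu ^ 2 * exp (2 * t) * g t ^ 2).
Proof.
  unfold bessel_energy. auto_derive.
  - repeat split; auto.
  - rewrite ug, ug1. ring.
Qed.

Lemma bessel_energy_incr (a b : R) : a <= b -> bessel_energy a <= bessel_energy b.
Proof.
  intros hab. eapply is_derive_incr; [exact hab|intros; apply is_derive_bessel_energy|].
  intros t _. pose proof (exp_pos (2 * t)). pose proof (pow2_ge_0 (g t)). pose proof (pow2_ge_0 nu).
  repeat first [lra | apply Rmult_le_pos].
Qed.

Lemma exp_2_le_1 (t : R) : t <= 0 -> exp (2 * t) <= 1.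
Proof. intros ht; rewrite <- exp_0; apply exp_le_compat; lra. Qed.

Lemma bessel_energy_nonneg (t : R) : 0 <= bessel_energy t.
Proof.
  apply incr_nonneg with (f := bessel_energy) (b := t)
    (df := fun t => 2 * nu ^ 2 * exp (2 * t) * g t ^ 2).
  - intros; apply is_derive_bessel_energy.
  - intros s _. pose proof (exp_pos (2 * s)). pose proof (pow2_ge_0 (g s)). pose proof (pow2_ge_0 nu).
    repeat first [lra | apply Rmult_le_pos].
  - intros e he.
    assert (hse : 0 < sqrt e) by (apply sqrt_lt_R0, he).
    destruct (ode_lim _ _ _ ode (sqrt e / nu)) as [T hT]; [apply Rdiv_lt_0_compat; lra|].
    exists (Rmin T 0); intros s hs.
    assert (hs1 := Rle_trans _ _ _ hs (Rmin_l _ _)).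
    assert (hs2 := Rle_trans _ _ _ hs (Rmin_r _ _)).
    destruct (hT s hs1) as [h _].
    assert (hg : nu ^ 2 * g s ^ 2 <= e).
    { rewrite <- (pow2_abs (g s)).
      rewrite <- (pow2_sqrt e) by lra.
      replace (sqrt e) with (nu * (sqrt e / nu)) by (field; lra).
      rewrite Rpow_mult_distr. apply Rmult_le_compat_l; [apply pow2_ge_0|].
      apply pow_incr. split; [apply Rabs_pos|exact h]. }
    unfold bessel_energy. pose proof (exp_pos (2 * s)). pose proof (exp_2_le_1 s hs2).
    pose proof (pow2_ge_0 (g1 s)). pose proof (pow2_ge_0 (g s)). pose proof (pow2_ge_0 nu).
    assert (0 <= exp (2 * s) * (nu ^ 2 * g s ^ 2)) by (repeat first [lra | apply Rmult_le_pos]).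
    nra.
  - apply Rle_refl.
Qed.

(** If the energy vanished at [t], it would vanish everywhere to the left. Its derivative, a
    positive multiple of [g^2], would vanish there too, against [ode_neq0]. *)
Lemma bessel_energy_pos (t : R) : 0 < bessel_energy t.
Proof.
  destruct (bessel_energy_nonneg t) as [h|h]; [exact h|exfalso].
  destruct (ode_neq0 _ _ _ ode (t - 1)) as [s [hs hgs]].
  assert (h0 : forall r, r < t -> bessel_energy r = 0).
  { intros r hr. pose proof (bessel_energy_incr r t). pose proof (bessel_energy_nonneg r). lra. }
  assert (d0 : is_derive bessel_energy s 0).
  { apply is_derive_ext_loc with (fun _ => 0); [|auto_derive; auto].
    exists (mkposreal 1 Rlt_0_1). intros y hy. symmetry; apply h0.
    unfold ball in hy; simpl in hy; unfold AbsRing_ball, abs, minus, plus, opp in hy; simpl in hy.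
    apply Rabs_def2 in hy. lra. }
  assert (e := is_derive_unique _ _ _ d0).
  rewrite (is_derive_unique _ _ _ (is_derive_bessel_energy s)) in e.
  apply Rmult_integral in e. destruct e as [e|e].
  - pose proof (exp_pos (2 * s)).
    assert (0 < 2 * nu ^ 2 * exp (2 * s)).
    { apply Rmult_lt_0_compat; [|lra]. pose proof (pow_lt nu 2 hnu). lra. }
    lra.
  - apply hgs. apply Rsqr_0_uniq. unfold Rsqr. simpl in e. lra.
Qed.

(** The product tends to [0] at [-oo], and its derivative [g'^2 + nu^2 (1 - e^(2t)) g^2] is
    nonnegative left of the turning point. Thus [g^2] is nondecreasing there. *)
Lemma bessel_prod_nonneg (t : R) : t <= 0 -> 0 <= g t * g1 t.
Proof.
  apply incr_nonneg with (f := fun t => g t * g1 t) (b := 0)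
    (df := fun t => g1 t ^ 2 + nu ^ 2 * (1 - exp (2 * t)) * g t ^ 2).
  - intros s _. auto_derive; [repeat split; auto|]. rewrite ug, ug1. ring.
  - intros s hs. pose proof (exp_2_le_1 s hs).
    pose proof (pow2_ge_0 (g1 s)). pose proof (pow2_ge_0 (g s)). pose proof (pow2_ge_0 nu).
    assert (0 <= nu ^ 2 * (1 - exp (2 * s)) * g s ^ 2) by (repeat first [lra | apply Rmult_le_pos]).
    lra.
  - intros e he.
    assert (hse : 0 < sqrt e) by (apply sqrt_lt_R0, he).
    destruct (ode_lim _ _ _ ode (sqrt e) hse) as [T hT]. exists T; intros s hs.
    destruct (hT s hs) as [h h1].
    assert (hm : Rabs (g s * g1 s) <= sqrt e * sqrt e).
    { rewrite Rabs_mult. apply Rmult_le_compat; auto using Rabs_pos. }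
    rewrite sqrt_sqrt in hm by lra. apply Rabs_le_between in hm. lra.
Qed.

(** In the original variable: every positive zero of [J_nu] exceeds [nu]. A zero at [t] would force
    the nondecreasing [g^2] to vanish on all of the left. *)
Lemma bessel_neq0_left (t : R) : t <= 0 -> g t <> 0.
Proof.
  intros ht h. destruct (ode_neq0 _ _ _ ode t) as [s [hs hgs]]. apply hgs.
  assert (hi : g s ^ 2 <= g t ^ 2).
  { apply is_derive_incr with (f := fun t => g t ^ 2) (df := fun t => 2 * (g t * g1 t)); [exact hs| |].
    - intros r _. auto_derive; [repeat split; auto|]. rewrite ug. ring.
    - intros r hr. assert (hp := bessel_prod_nonneg r). lra. }
  rewrite h in hi. pose proof (pow2_ge_0 (g s)).
  apply Rsqr_0_uniq. unfold Rsqr. simpl in *. lra.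
Qed.

(** The rate is frozen at its smallest value [mu], attained at [- delta]. Then [g^2 e^(-2 mu t)] is
    nondecreasing, which avoids dividing by [g]. *)
Lemma bessel_left_decay (delta t : R) : 0 < delta -> t <= - delta ->
  g t ^ 2 <= g (- delta) ^ 2 * exp (2 * (nu * sqrt (1 - exp (2 * - delta))) * (t + delta)).
Proof.
  intros hdl ht. set (mu := nu * _).
  assert (hE : exp (2 * - delta) <= 1) by (apply exp_2_le_1; lra).
  assert (hmu : 0 <= mu) by (apply Rmult_le_pos; [lra|apply sqrt_pos]).
  assert (hmu2 : mu ^ 2 = nu ^ 2 * (1 - exp (2 * - delta))).
  { unfold mu. rewrite Rpow_mult_distr, pow2_sqrt by lra. reflexivity. }
  assert (hi : g t ^ 2 * exp (- (2 * mu * t)) <= g (- delta) ^ 2 * exp (- (2 * mu * - delta))).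
  { apply is_derive_incr with (f := fun t => g t ^ 2 * exp (- (2 * mu * t)))
      (df := fun t => 2 * exp (- (2 * mu * t)) * (g t * g1 t - mu * g t ^ 2)); [exact ht| |].
    - intros r _. auto_derive; [repeat split; auto|]. rewrite ug. ring.
    - intros r hr. pose proof (exp_pos (- (2 * mu * r))).
      apply Rmult_le_pos; [lra|].
      assert (hp := bessel_prod_nonneg r ltac:(lra)).
      assert (hen := bessel_energy_pos r). unfold bessel_energy in hen.
      assert (he : exp (2 * r) <= exp (2 * - delta)) by (apply exp_le_compat; lra).
      assert (hq : mu ^ 2 * g r ^ 2 <= g1 r ^ 2).
      { rewrite hmu2. pose proof (pow2_ge_0 (g r)). pose proof (pow2_ge_0 nu).
        assert (0 <= nu ^ 2 * (exp (2 * - delta) - exp (2 * r)) * g r ^ 2)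
          by (repeat first [lra | apply Rmult_le_pos]).
        nra. }
      (* Since [g g'] is nonnegative, squares may be compared. The squared inequality is the energy
         bound [hq] times [g^2]. *)
      cut (mu * g r ^ 2 <= g r * g1 r); [lra|].
      apply Rsqr_incr_0_var; [|exact hp]. unfold Rsqr.
      pose proof (pow2_ge_0 (g r)).
      replace (mu * g r ^ 2 * (mu * g r ^ 2)) with (g r ^ 2 * (mu ^ 2 * g r ^ 2)) by ring.
      replace (g r * g1 r * (g r * g1 r)) with (g r ^ 2 * g1 r ^ 2) by ring.
      apply Rmult_le_compat_l; lra. }
  apply Rmult_le_compat_r with (r := exp (2 * mu * t)) in hi; [|left; apply exp_pos].
  rewrite !Rmult_assoc, <- !exp_plus in hi.
  rewrite Rplus_opp_l, exp_0, Rmult_1_r in hi.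
  eapply Rle_trans; [exact hi|]. right. f_equal. f_equal. ring.
Qed.

End Energy.

(** * The adiabatic invariant to the right of the turning point *)

Definition momentum (t : R) : R := sqrt (exp (2 * t) - 1).

Lemma momentum_sqr (t : R) : 0 <= t -> momentum t ^ 2 = exp (2 * t) - 1.
Proof.
  intros ht. apply pow2_sqrt. pose proof (exp_ineq1_le (2 * t)). lra.
Qed.

Lemma momentum_pos (t : R) : 0 < t -> 0 < momentum t.
Proof.
  intros ht. apply sqrt_lt_R0. pose proof (exp_ineq1_le (2 * t)). lra.
Qed.

Lemma momentum_le (s t : R) : s <= t -> momentum s <= momentum t.
Proof.
  intros h. apply sqrt_le_1_alt. assert (exp (2 * s) <= exp (2 * t)) by (apply exp_le_compat; lra). lra.
Qed.

Lemma is_derive_momentum (t : R) : 0 < t ->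
  is_derive momentum t ((1 + momentum t ^ 2) / momentum t).
Proof.
  intros ht. pose proof (momentum_pos t ht). rewrite (momentum_sqr t) by lra.
  unfold momentum in *. pose proof (exp_ineq1_le (2 * t)).
  auto_derive; [lra|].
  replace (exp (2 * t) + - (1)) with (exp (2 * t) - 1) by ring. field. lra.
Qed.

(* [G] is the leading-order WKB invariant; adding [b g g'] makes its derivative
   [O(G / nu)], so [G] changes at most by a constant factor on [t >= tau]. *)
Lemma bessel_right_decay (nu : R) (g g1 : R -> R) (tau t1 t : R) :
  bessel_ode nu g g1 -> 0 < tau -> tau <= t1 -> t1 <= t -> g1 t1 = 0 ->
  (1 + momentum tau ^ 2) / momentum tau ^ 3 <= nu ->
  momentum t * g t ^ 2 <= 9 * (momentum t1 * g t1 ^ 2).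
Proof.
  intros ode htau ht1 ht hc hnu.
  assert (hn : 0 < nu) by exact (ode_order _ _ _ ode).
  assert (dg := ode_derive _ _ _ ode). assert (dg1 := ode_derive1 _ _ _ ode).
  set (v := momentum) in *.
  assert (hv : forall s, tau <= s -> 0 < v s) by (intros; apply momentum_pos; lra).
  (* [b = v' / v^2] is forced: [G' = v' (nu^2 g^2 - g'^2 / v^2)] cancels against [b (g g')'],
     leaving [H' = b' g g'], and [c = - b']. *)
  set (b := fun s => (1 + v s ^ 2) / v s ^ 3).
  set (c := fun s => (3 / v s ^ 4 + 1 / v s ^ 2) * ((1 + v s ^ 2) / v s)).
  set (G := fun s => nu ^ 2 * v s * g s ^ 2 + g1 s ^ 2 / v s).
  set (H := fun s => G s + b s * (g s * g1 s)).
  assert (uv : forall s, tau <= s -> Derive (fun x => v x) s = (1 + v s ^ 2) / v s).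
  { intros s hs; apply is_derive_unique, is_derive_momentum; lra. }
  assert (ev : forall s, tau <= s -> ex_derive (fun x => v x) s).
  { intros s hs; eexists; apply is_derive_momentum; lra. }
  assert (db : forall s, tau <= s -> is_derive b s (- c s)).
  { intros s hs. assert (h := hv s hs). unfold b, c. auto_derive.
    - repeat split; auto. apply Rgt_not_eq. repeat apply Rmult_lt_0_compat; lra.
    - rewrite uv by exact hs. field. lra. }
  assert (hcp : forall s, tau <= s -> 0 < c s).
  { intros s hs. assert (h := hv s hs). unfold c.
    assert (0 < 3 / v s ^ 4) by (apply Rdiv_lt_0_compat; [lra|apply pow_lt, h]).
    assert (0 < 1 / v s ^ 2) by (apply Rdiv_lt_0_compat; [lra|apply pow_lt, h]).
    assert (0 < (1 + v s ^ 2) / v s)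
      by (apply Rdiv_lt_0_compat; [pose proof (pow2_ge_0 (v s)); lra|exact h]).
    apply Rmult_lt_0_compat; lra. }
  assert (hb : forall s, tau <= s -> 0 <= b s <= nu).
  { intros s hs. assert (h := hv s hs). split.
    - left. apply Rdiv_lt_0_compat; [pose proof (pow2_ge_0 (v s)); lra|apply pow_lt, h].
    - eapply Rle_trans; [|exact hnu].
      apply (is_derive_decr b (fun s => - c s) tau s hs).
      + intros r hr; apply db; lra.
      + intros r hr; specialize (hcp r ltac:(lra)); lra. }
  (* Arithmetic-geometric mean: the two terms of [G] have geometric mean [nu |g g'|]. *)
  assert (hGp : forall s, tau <= s -> Rabs (g s * g1 s) * (2 * nu) <= G s).
  { intros s hs. assert (h := hv s hs). unfold G.
    assert (e : G s - Rabs (g s * g1 s) * (2 * nu)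
                = / v s * (nu * v s * Rabs (g s) - Rabs (g1 s)) ^ 2).
    { unfold G. rewrite Rabs_mult, <- (pow2_abs (g s)), <- (pow2_abs (g1 s)). field. lra. }
    assert (0 <= / v s * (nu * v s * Rabs (g s) - Rabs (g1 s)) ^ 2).
    { apply Rmult_le_pos; [left; apply Rinv_0_lt_compat, h|apply pow2_ge_0]. }
    unfold G in e. lra. }
  assert (hHG : forall s, tau <= s -> G s / 2 <= H s <= 3 / 2 * G s).
  { intros s hs. assert (hb' := hb s hs). assert (hg := hGp s hs).
    assert (hab : Rabs (b s * (g s * g1 s)) <= G s / 2).
    { rewrite Rabs_mult, (Rabs_pos_eq (b s)) by lra.
      pose proof (Rabs_pos (g s * g1 s)).
      assert (b s * Rabs (g s * g1 s) <= nu * Rabs (g s * g1 s))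
        by (apply Rmult_le_compat_r; lra).
      lra. }
    apply Rabs_le_between in hab. unfold H. lra. }
  (* Integrating factor: the derivative is [- c e^(b/nu) (g g' + H/nu)], and [H >= G/2 >= nu |g g'|]
     makes the bracket nonnegative. *)
  assert (hi : H t * exp (b t / nu) <= H t1 * exp (b t1 / nu)).
  { apply is_derive_decr with (f := fun s => H s * exp (b s / nu))
      (df := fun s => - c s * exp (b s / nu) * (g s * g1 s + H s / nu)); [exact ht| |].
    - intros s [hs _]. assert (hs' : tau <= s) by lra. assert (h := hv s hs').
      assert (dH : is_derive H s (- c s * (g s * g1 s))).
      { unfold H, G. auto_derive.
        - repeat split; auto; try (eexists; apply dg); try (eexists; apply dg1);
            try (eexists; apply db, hs'); lra.
        - rewrite uv by exact hs'.
          rewrite (is_derive_unique (fun x : R => b x) _ _ (db s hs')).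
          rewrite (is_derive_unique (fun x : R => g x) _ _ (dg s)).
          rewrite (is_derive_unique (fun x : R => g1 x) _ _ (dg1 s)).
          replace (1 - exp (2 * s)) with (- v s ^ 2)
            by (unfold v; rewrite momentum_sqr by lra; ring).
          unfold b. field. lra. }
      auto_derive.
      + repeat split; [eexists; apply dH|eexists; apply db, hs'].
      + rewrite (is_derive_unique (fun x : R => H x) _ _ dH).
        rewrite (is_derive_unique (fun x : R => b x) _ _ (db s hs')). unfold Rdiv. ring.
    - intros s [hs _]. assert (hs' : tau <= s) by lra.
      pose proof (hcp s hs'). pose proof (exp_pos (b s / nu)).
      destruct (hHG s hs') as [h1 _]. assert (h2 := hGp s hs').
      assert (0 <= g s * g1 s + H s / nu).
      { apply Rmult_le_reg_r with nu; [lra|].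
        replace ((g s * g1 s + H s / nu) * nu) with (g s * g1 s * nu + H s) by (field; lra).
        pose proof (Rle_abs (- (g s * g1 s))) as h3. rewrite Rabs_Ropp in h3.
        apply Rmult_le_compat_r with (r := nu) in h3; lra. }
      assert (0 <= c s * exp (b s / nu)) by (apply Rmult_le_pos; lra).
      nra. }
  assert (h0 : tau <= t) by lra.
  destruct (hHG t h0) as [a1 _]. destruct (hHG t1 ht1) as [_ a2].
  assert (hG0 : forall s, tau <= s -> 0 <= G s).
  { intros s hs. pose proof (hGp s hs). pose proof (Rabs_pos (g s * g1 s)).
    assert (0 <= Rabs (g s * g1 s) * (2 * nu)) by (apply Rmult_le_pos; lra). lra. }
  assert (hGt := hG0 t h0). assert (hGt1 := hG0 t1 ht1).
  assert (x1 : 1 <= exp (b t / nu)).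
  { rewrite <- exp_0. apply exp_le_compat.
    destruct (hb t h0). apply Rmult_le_pos; [lra|left; apply Rinv_0_lt_compat, hn]. }
  assert (x2 : exp (b t1 / nu) <= 3).
  { eapply Rle_trans; [|exact exp_le_3]. apply exp_le_compat.
    destruct (hb t1 ht1). apply Rmult_le_reg_r with nu; [lra|]. field_simplify; lra. }
  assert (x0 := exp_pos (b t1 / nu)).
  (* [9 = 2 * (3/2) * 3]: two factors from comparing [H] with [G], and [e <= 3] from the integrating
     factor. *)
  assert (hfin : G t <= 9 * G t1).
  { assert (H t <= H t * exp (b t / nu)) by nra.
    assert (H t1 * exp (b t1 / nu) <= 3 / 2 * G t1 * 3) by (apply Rmult_le_compat; nra).
    lra. }
  unfold G in hfin. rewrite hc in hfin.
  assert (0 <= g1 t ^ 2 / v t).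
  { apply Rmult_le_pos; [apply pow2_ge_0|left; apply Rinv_0_lt_compat, hv, h0]. }
  apply Rmult_le_reg_l with (nu ^ 2); [apply pow_lt, hn|].
  replace (0 ^ 2 / v t1) with 0 in hfin by (unfold Rdiv; ring). lra.
Qed.

(** * Sturm comparison *)

(* At an interior positive maximum of [u / v] the Wronskian [u' v - u v'] vanishes,
   yet it increases there because [u'' / u > v'' / v]. *)
Lemma sturm_nonpos (u u1 A v v1 B : R -> R) (a b : R) : a < b ->
  (forall t, a <= t <= b -> is_derive u t (u1 t)) ->
  (forall t, a <= t <= b -> is_derive u1 t (A t * u t)) ->
  (forall t, a <= t <= b -> is_derive v t (v1 t)) ->
  (forall t, a <= t <= b -> is_derive v1 t (B t * v t)) ->
  (forall t, a <= t <= b -> B t < A t) ->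
  (forall t, a <= t <= b -> 0 < v t) -> u a = 0 -> u b = 0 ->
  forall t, a <= t <= b -> u t <= 0.
Proof.
  intros hab du du1 dv dv1 hAB hv ha hb t0 ht0.
  apply Rnot_lt_le; intros hpos.
  set (z := fun t => u t / v t). set (W := fun t => u1 t * v t - u t * v1 t).
  assert (dz : forall t, a <= t <= b -> is_derive z t (W t / v t ^ 2)).
  { intros t ht. assert (h := hv t ht). unfold z, W. auto_derive.
    - repeat split; [eexists; apply du, ht|eexists; apply dv, ht|lra].
    - rewrite (is_derive_unique (fun x : R => u x) _ _ (du t ht)).
      rewrite (is_derive_unique (fun x : R => v x) _ _ (dv t ht)). field; lra. }
  assert (dW : forall t, a <= t <= b -> is_derive W t ((A t - B t) * (u t * v t))).
  { intros t ht. unfold W. auto_derive.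
    - repeat split; eexists; [apply du1, ht|apply dv, ht|apply du, ht|apply dv1, ht].
    - rewrite (is_derive_unique (fun x : R => u x) _ _ (du t ht)).
      rewrite (is_derive_unique (fun x : R => v x) _ _ (dv t ht)).
      rewrite (is_derive_unique (fun x : R => u1 x) _ _ (du1 t ht)).
      rewrite (is_derive_unique (fun x : R => v1 x) _ _ (dv1 t ht)). ring. }
  destruct (continuity_ab_maj z a b) as [m [hmax hm]]; [lra| |].
  { intros c hc. eapply is_derive_continuity_pt, dz, hc. }
  assert (hzm : 0 < z m).
  { apply Rlt_le_trans with (z t0); [|apply hmax, ht0].
    apply Rdiv_lt_0_compat; [exact hpos|apply hv, ht0]. }
  assert (hum : 0 < u m).
  { replace (u m) with (z m * v m) by (unfold z; field; apply Rgt_not_eq, hv, hm).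
    apply Rmult_lt_0_compat; [exact hzm|apply hv, hm]. }
  assert (hma : a < m) by (destruct (proj1 hm) as [h|h]; [exact h|subst; lra]).
  assert (hmb : m < b) by (destruct (proj2 hm) as [h|h]; [exact h|subst; lra]).
  assert (hWm : W m = 0).
  { assert (D := dz m hm).
    assert (pr : derivable_pt z m) by (exists (W m / v m ^ 2); apply is_derive_Reals, D).
    assert (e := deriv_maximum z a b m pr hma hmb).
    rewrite Derive_Reals, (is_derive_unique _ _ _ D) in e.
    specialize (e ltac:(intros; apply hmax; lra)).
    assert (h := hv m hm).
    replace (W m) with (W m / v m ^ 2 * v m ^ 2) by (field; lra). rewrite e; ring. }
  assert (hc : continuity_pt u m) by (eapply is_derive_continuity_pt, du, hm).
  destruct (hc (u m) hum) as [d [hd hd']].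
  set (m2 := Rmin b (m + d / 2)).
  assert (hm2 : m < m2) by (apply Rmin_glb_lt; lra).
  assert (hm2b : m2 <= b) by apply Rmin_l.
  assert (hm2d : m2 <= m + d / 2) by apply Rmin_r.
  assert (hup : forall t, m <= t <= m2 -> 0 < u t).
  { intros t ht. destruct (Req_dec t m) as [->|hne]; [exact hum|].
    assert (h : R_dist (u t) (u m) < u m).
    { apply hd'. split; [split; [exact I|lra]|]. simpl; unfold R_dist.
      rewrite Rabs_pos_eq; lra. }
    unfold R_dist in h. apply Rabs_def2 in h. lra. }
  assert (hWp : forall t, m < t <= m2 -> 0 < W t).
  { intros t ht.
    destruct (is_derive_MVT W (fun t => (A t - B t) * (u t * v t)) m t) as [c [hc1 e]]; [lra| |].
    { intros s hs; apply dW; lra. }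
    assert (0 < (A c - B c) * (u c * v c)).
    { assert (h1 := hAB c ltac:(lra)). assert (h2 := hup c ltac:(lra)).
      assert (h3 := hv c ltac:(lra)).
      repeat apply Rmult_lt_0_compat; lra. }
    rewrite hWm in e. nra. }
  assert (hWz : forall t, m <= t <= m2 -> 0 <= W t / v t ^ 2).
  { intros t ht. assert (h := hv t ltac:(lra)).
    apply Rmult_le_pos; [|left; apply Rinv_0_lt_compat, pow_lt, h].
    destruct (proj1 ht) as [h1|h1]; [left; apply hWp; lra|subst t; lra]. }
  (* [W] vanishes at [m] itself, so strict growth of [z] is extracted only on [[m1, m2]], while
     [[m, m1]] contributes weak growth. *)
  set (m1 := (m + m2) / 2).
  assert (h1 : z m <= z m1).
  { apply is_derive_incr with (fun t => W t / v t ^ 2); [unfold m1; lra| |].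
    - intros s hs; apply dz; unfold m1 in hs; lra.
    - intros s hs; apply hWz; unfold m1 in hs; lra. }
  destruct (is_derive_MVT z (fun t => W t / v t ^ 2) m1 m2) as [c [hc1 e]]; [unfold m1; lra| |].
  { intros s hs; apply dz; unfold m1 in hs; lra. }
  assert (h2 : 0 < W c / v c ^ 2).
  { unfold m1 in hc1. apply Rdiv_lt_0_compat; [apply hWp; lra|apply pow_lt, hv; lra]. }
  assert (h3 := hmax m2 ltac:(lra)).
  assert (0 < m2 - m1) by (unfold m1; lra). nra.
Qed.

(** [v] oscillates strictly faster than [u], so it can stay positive between two zeros of [u] only
    if [u] is trivial. The one-sided lemma is applied to [u] and to [- u]. *)
Lemma sturm_comparison (u u1 A v v1 B : R -> R) (a b : R) : a < b ->
  (forall t, a <= t <= b -> is_derive u t (u1 t)) ->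
  (forall t, a <= t <= b -> is_derive u1 t (A t * u t)) ->
  (forall t, a <= t <= b -> is_derive v t (v1 t)) ->
  (forall t, a <= t <= b -> is_derive v1 t (B t * v t)) ->
  (forall t, a <= t <= b -> B t < A t) ->
  (forall t, a <= t <= b -> 0 < v t) -> u a = 0 -> u b = 0 ->
  forall t, a <= t <= b -> u t = 0.
Proof.
  intros hab du du1 dv dv1 hAB hv ha hb t ht.
  assert (h1 := sturm_nonpos u u1 A v v1 B a b hab du du1 dv dv1 hAB hv ha hb t ht).
  assert (h2 : - u t <= 0).
  { apply (sturm_nonpos (fun t => - u t) (fun t => - u1 t) A v v1 B a b); auto; try lra.
    - intros s hs. auto_derive; [eexists; apply du, hs|].
      rewrite (is_derive_unique (fun x : R => u x) _ _ (du s hs)). ring.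
    - intros s hs. auto_derive; [eexists; apply du1, hs|].
      rewrite (is_derive_unique (fun x : R => u1 x) _ _ (du1 s hs)). ring. }
  lra.
Qed.

(** * WKB comparison functions and the spacing of zeros *)

Definition phase (t : R) : R := momentum t - atan (momentum t).

Lemma is_derive_phase (t : R) : 0 < t -> is_derive phase t (momentum t).
Proof.
  intros ht. assert (hm := momentum_pos t ht). unfold phase.
  assert (dm := is_derive_momentum t ht).
  auto_derive; [repeat split; eexists; apply dm|].
  rewrite (is_derive_unique (fun x : R => momentum x) _ _ dm).
  pose proof (pow2_ge_0 (momentum t)). field; nra.
Qed.

Lemma phase_lt (s t : R) : 0 < s -> s < t -> phase s < phase t.
Proof.
  intros hs hst.
  destruct (is_derive_MVT phase momentum s t hst) as [c [hc e]].
  { intros r hr; apply is_derive_phase; lra. }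
  assert (h := momentum_pos c ltac:(lra)). nra.
Qed.

Lemma phase_le (s t : R) : 0 < s -> s <= t -> phase s <= phase t.
Proof. intros hs [h| ->]; [left; apply phase_lt; assumption|apply Rle_refl]. Qed.

(** Here [sqrt (momentum t)] is [q^(1/4)]. As the phase has derivative [q^(1/2)], this amplitude
    makes the cosine terms of the second derivative cancel. *)
Definition wkb (kappa c t : R) : R := sin (kappa * phase t + c) / sqrt (momentum t).

Definition wkb1 (kappa c t : R) : R :=
  - (1 + sqrt (momentum t) ^ 4) / (2 * sqrt (momentum t) ^ 5) * sin (kappa * phase t + c)
  + kappa * sqrt (momentum t) * cos (kappa * phase t + c).

(** This is [q^(1/4) (q^(-1/4))''] with [q = e^(2t) - 1]. *)
Definition wkb_error (t : R) : R :=
  (1 + / (exp (2 * t) - 1)) * (1 + 5 * / (exp (2 * t) - 1)) / 4.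

Lemma exp_2_minus_1_pos (t : R) : 0 < t -> 0 < exp (2 * t) - 1.
Proof. intros ht; pose proof (exp_ineq1_le (2 * t)); lra. Qed.

Lemma wkb_error_pos (t : R) : 0 < t -> 0 < wkb_error t.
Proof.
  intros ht; unfold wkb_error.
  assert (h := Rinv_0_lt_compat _ (exp_2_minus_1_pos t ht)).
  apply Rdiv_lt_0_compat; [apply Rmult_lt_0_compat; lra|lra].
Qed.

Lemma wkb_error_le (s t : R) : 0 < s -> s <= t -> wkb_error t <= wkb_error s.
Proof.
  intros hs hst; unfold wkb_error.
  assert (h := exp_2_minus_1_pos s hs).
  assert (hi : / (exp (2 * t) - 1) <= / (exp (2 * s) - 1)).
  { apply Rinv_le_contravar; [exact h|].
    assert (exp (2 * s) <= exp (2 * t)) by (apply exp_le_compat; lra). lra. }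
  assert (hp := Rinv_0_lt_compat _ (exp_2_minus_1_pos t ltac:(lra))).
  apply Rmult_le_compat_r; [lra|]. apply Rmult_le_compat; lra.
Qed.

(** With [s = q^(1/4)] one has [v = s^2] and [q = s^4]. The WKB derivatives become rational in [s]
    and fall to [field]. *)
Lemma is_derive_sqrt_momentum (t : R) : 0 < t ->
  is_derive (fun t => sqrt (momentum t)) t
    ((1 + sqrt (momentum t) ^ 4) / (2 * sqrt (momentum t) ^ 3)).
Proof.
  intros ht. assert (hm := momentum_pos t ht). assert (dm := is_derive_momentum t ht).
  assert (hs := sqrt_lt_R0 _ hm).
  auto_derive.
  - split; [eexists; apply dm|split; [lra|exact I]].
  - rewrite (is_derive_unique (fun x : R => momentum x) _ _ dm).
    rewrite <- (pow2_sqrt (momentum t)) at 1 2 by lra. field. lra.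
Qed.

Lemma is_derive_wkb (kappa c t : R) : 0 < t ->
  is_derive (wkb kappa c) t (wkb1 kappa c t).
Proof.
  intros ht. assert (hm := momentum_pos t ht). assert (hs := sqrt_lt_R0 _ hm).
  assert (ds := is_derive_sqrt_momentum t ht). assert (dp := is_derive_phase t ht).
  unfold wkb, wkb1. set (s := fun t => sqrt (momentum t)) in *.
  change (is_derive (fun t => sin (kappa * phase t + c) / s t) t
    (- (1 + s t ^ 4) / (2 * s t ^ 5) * sin (kappa * phase t + c)
     + kappa * s t * cos (kappa * phase t + c))).
  assert (hst : 0 < s t) by exact hs.
  assert (e : momentum t = s t ^ 2) by (unfold s; rewrite pow2_sqrt; lra).
  change (is_derive s t ((1 + s t ^ 4) / (2 * s t ^ 3))) in ds.
  auto_derive.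
  - repeat split; [eexists; apply dp|eexists; apply ds|lra].
  - rewrite (is_derive_unique (fun x : R => phase x) _ _ dp).
    rewrite (is_derive_unique (fun x : R => s x) _ _ ds). rewrite e. field. lra.
Qed.

Lemma is_derive_wkb1 (kappa c t : R) : 0 < t ->
  is_derive (wkb1 kappa c) t
    ((wkb_error t - kappa ^ 2 * (exp (2 * t) - 1)) * wkb kappa c t).
Proof.
  intros ht. assert (hm := momentum_pos t ht). assert (hs := sqrt_lt_R0 _ hm).
  assert (ds := is_derive_sqrt_momentum t ht). assert (dp := is_derive_phase t ht).
  unfold wkb, wkb1, wkb_error. set (s := fun t => sqrt (momentum t)) in *.
  assert (hst : 0 < s t) by exact hs.
  assert (e : momentum t = s t ^ 2) by (unfold s; rewrite pow2_sqrt; lra).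
  assert (e4 : exp (2 * t) - 1 = s t ^ 4)
    by (rewrite <- momentum_sqr, e by lra; ring).
  rewrite e4.
  change (is_derive (fun t =>
     - (1 + s t ^ 4) / (2 * s t ^ 5) * sin (kappa * phase t + c)
     + kappa * s t * cos (kappa * phase t + c)) t
    (((1 + / s t ^ 4) * (1 + 5 * / s t ^ 4) / 4 - kappa ^ 2 * s t ^ 4) *
     (sin (kappa * phase t + c) / s t))).
  change (is_derive s t ((1 + s t ^ 4) / (2 * s t ^ 3))) in ds.
  auto_derive.
  - repeat split; try (eexists; apply dp); try (eexists; apply ds).
    apply Rgt_not_eq. repeat apply Rmult_lt_0_compat; lra.
  - rewrite (is_derive_unique (fun x : R => phase x) _ _ dp).
    rewrite (is_derive_unique (fun x : R => s x) _ _ ds). rewrite e. field. lra.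
Qed.

(** Choose [kappa <= nu] so that [kappa * phase] advances by exactly [PI] over [[a, b]]. Without a
    zero, [g a * g t] is positive and Sturm comparison annihilates a WKB function that is positive
    at the midpoint. *)
Lemma bessel_zero_exists (nu : R) (g g1 : R -> R) (a b : R) :
  bessel_ode nu g g1 -> 0 < a -> a < b -> PI / nu <= phase b - phase a ->
  exists z, a <= z <= b /\ g z = 0.
Proof.
  intros ode ha hab hph.
  assert (hn := ode_order _ _ _ ode).
  assert (dg := ode_derive _ _ _ ode). assert (dg1 := ode_derive1 _ _ _ ode).
  apply Classical_Prop.NNPP; intros hno.
  assert (hcont : continuity g) by (intros x; eapply is_derive_continuity_pt, dg).
  assert (hsign : forall t, a <= t <= b -> 0 < g a * g t).
  { intros t ht. apply Rnot_le_lt; intros h.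
    destruct (IVT_cor g a t hcont (proj1 ht) h) as [z [hz e]].
    apply hno. exists z; split; [lra|exact e]. }
  assert (hD := phase_lt a b ha hab).
  set (kappa := PI / (phase b - phase a)).
  assert (hpi := PI_RGT_0).
  assert (hk : 0 < kappa) by (apply Rdiv_lt_0_compat; lra).
  assert (hkn : kappa <= nu).
  { unfold kappa. apply Rmult_le_reg_r with (phase b - phase a); [lra|].
    apply Rmult_le_compat_l with (r := nu) in hph; [|lra].
    replace (nu * (PI / nu)) with PI in hph by (field; lra). field_simplify; lra. }
  set (c := - (kappa * phase a)).
  set (m := (a + b) / 2).
  assert (hz : wkb kappa c m = 0).
  { apply (sturm_comparison (wkb kappa c) (wkb1 kappa c)
      (fun t => wkb_error t - kappa ^ 2 * (exp (2 * t) - 1))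
      (fun t => g a * g t) (fun t => g a * g1 t)
      (fun t => nu ^ 2 * (1 - exp (2 * t))) a b hab).
    - intros t ht; apply is_derive_wkb; lra.
    - intros t ht; apply is_derive_wkb1; lra.
    - intros t _. auto_derive; [eexists; apply dg|].
      rewrite (is_derive_unique (fun x : R => g x) _ _ (dg t)). ring.
    - intros t _. auto_derive; [eexists; apply dg1|].
      rewrite (is_derive_unique (fun x : R => g1 x) _ _ (dg1 t)). ring.
    - intros t ht. pose proof (wkb_error_pos t ltac:(lra)).
      pose proof (exp_2_minus_1_pos t ltac:(lra)).
      assert (kappa ^ 2 <= nu ^ 2) by (apply pow_incr; lra).
      assert (kappa ^ 2 * (exp (2 * t) - 1) <= nu ^ 2 * (exp (2 * t) - 1))
        by (apply Rmult_le_compat_r; lra).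
      lra.
    - exact hsign.
    - unfold wkb, c. rewrite Rplus_opp_r, sin_0. unfold Rdiv; ring.
    - unfold wkb, c. replace (kappa * phase b + - (kappa * phase a)) with PI
        by (unfold kappa; field; lra).
      rewrite sin_PI. unfold Rdiv; ring.
    - unfold m; lra. }
  assert (hm1 := phase_lt a m ha ltac:(unfold m; lra)).
  assert (hm2 := phase_lt m b ltac:(unfold m; lra) ltac:(unfold m; lra)).
  assert (0 < wkb kappa c m); [|lra].
  unfold wkb. apply Rdiv_lt_0_compat; [|apply sqrt_lt_R0, momentum_pos; unfold m; lra].
  replace (kappa * phase m + c) with (kappa * (phase m - phase a)) by (unfold c; ring).
  apply sin_gt_0; [apply Rmult_lt_0_compat; lra|].
  replace PI with (kappa * (phase b - phase a)) at 1 by (unfold kappa; field; lra).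
  apply Rmult_lt_compat_l; lra.
Qed.

(* Shifting the argument by [rho] enlarges the coefficient enough to absorb the WKB error
   uniformly up to the turning point [t = 0]. *)
Lemma bessel_zero_gap (nu rho : R) (g g1 : R -> R) (a b : R) :
  bessel_ode nu g g1 -> 0 < rho -> wkb_error rho < nu ^ 2 * (exp (2 * rho) - 1) ->
  0 <= a -> a < b -> g a = 0 -> g b = 0 ->
  PI / nu <= phase (b + rho) - phase (a + rho).
Proof.
  intros ode hrho hbig ha hab hga hgb.
  assert (hn := ode_order _ _ _ ode).
  assert (dg := ode_derive _ _ _ ode). assert (dg1 := ode_derive1 _ _ _ ode).
  apply Rnot_lt_le; intros hlt.
  set (D := nu * (phase (b + rho) - phase (a + rho))).
  assert (hD : D < PI).
  { unfold D. apply Rmult_lt_compat_l with (r := nu) in hlt; [|exact hn].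
    replace (nu * (PI / nu)) with PI in hlt by (field; lra). exact hlt. }
  (* Centres the argument of the sine: it runs from [(PI - D)/2] to [(PI + D)/2], strictly inside
     [(0, PI)]. *)
  set (c := - (nu * phase (a + rho)) + (PI - D) / 2).
  assert (hz : forall t, a <= t <= b -> g t = 0).
  { apply (sturm_comparison g g1 (fun t => nu ^ 2 * (1 - exp (2 * t)))
      (fun t => wkb nu c (t + rho)) (fun t => wkb1 nu c (t + rho))
      (fun t => wkb_error (t + rho) - nu ^ 2 * (exp (2 * (t + rho)) - 1)) a b hab);
      auto.
    - intros t ht. assert (h := is_derive_wkb nu c (t + rho) ltac:(lra)).
      auto_derive; [eexists; apply h|].
      rewrite (is_derive_unique (fun x : R => wkb nu c x) _ _ h). ring.
    - intros t ht. assert (h := is_derive_wkb1 nu c (t + rho) ltac:(lra)).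
      auto_derive; [eexists; apply h|].
      rewrite (is_derive_unique (fun x : R => wkb1 nu c x) _ _ h). ring.
    - intros t ht.
      (* The shift gains [nu^2 e^(2t) (e^(2 rho) - 1)], at least its value at [t = 0], while the
         error is at most its value at [rho]. *)
      assert (h1 := wkb_error_le rho (t + rho) hrho ltac:(lra)).
      assert (h2 : 1 <= exp (2 * t)) by (rewrite <- exp_0; apply exp_le_compat; lra).
      replace (exp (2 * (t + rho))) with (exp (2 * t) * exp (2 * rho))
        by (rewrite <- exp_plus; f_equal; ring).
      assert (h3 := exp_2_minus_1_pos rho hrho).
      assert (h4 : 0 <= nu ^ 2 * ((exp (2 * t) - 1) * (exp (2 * rho) - 1))).
      { apply Rmult_le_pos; [apply pow2_ge_0|apply Rmult_le_pos; lra]. }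
      lra.
    - intros t ht.
      assert (h1 := phase_le (a + rho) (t + rho) ltac:(lra) ltac:(lra)).
      assert (h2 := phase_le (t + rho) (b + rho) ltac:(lra) ltac:(lra)).
      unfold wkb. apply Rdiv_lt_0_compat; [|apply sqrt_lt_R0, momentum_pos; lra].
      apply Rmult_le_compat_l with (r := nu) in h1; [|lra].
      apply Rmult_le_compat_l with (r := nu) in h2; [|lra].
      apply sin_gt_0; unfold c, D in *; lra. }
  (* A solution vanishing on [[a, b]] has [g = g' = 0] at some point, against positivity of the
     energy. *)
  destruct (is_derive_MVT g g1 a b hab) as [s [hs e]]; [intros; apply dg|].
  assert (hen := bessel_energy_pos nu g g1 ode s). unfold bessel_energy in hen.
  rewrite (hz s hs) in hen.
  assert (h1 : g1 s = 0).
  { apply Rmult_eq_reg_r with (b - a); [|lra]. lra. }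
  rewrite h1 in hen. lra.
Qed.

(** * Counting zeros *)

Lemma atan_le_id (v : R) : 0 <= v -> atan v <= v.
Proof.
  intros hv.
  assert (h : 0 - atan 0 <= v - atan v).
  { apply is_derive_incr with (f := fun x => x - atan x) (df := fun x => x ^ 2 / (1 + x ^ 2)).
    - exact hv.
    - intros t _. auto_derive; [exact I|]. pose proof (pow2_ge_0 t). field. nra.
    - intros t _. pose proof (pow2_ge_0 t).
      apply Rmult_le_pos; [lra|left; apply Rinv_0_lt_compat; lra]. }
  rewrite atan_0 in h. lra.
Qed.

Lemma phase_nonneg (t : R) : 0 <= phase t.
Proof.
  unfold phase. pose proof (atan_le_id (momentum t) (sqrt_pos _)). lra.
Qed.

Lemma momentum_surj (v : R) : 0 < v -> exists t, 0 < t /\ momentum t = v.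
Proof.
  intros hv. pose proof (pow_lt v 2 hv).
  exists (ln (1 + v ^ 2) / 2); split.
  - assert (0 < ln (1 + v ^ 2)) by (rewrite <- ln_1; apply ln_increasing; lra). lra.
  - unfold momentum. replace (2 * (ln (1 + v ^ 2) / 2)) with (ln (1 + v ^ 2)) by field.
    rewrite exp_ln by lra. replace (1 + v ^ 2 - 1) with (v ^ 2) by ring.
    apply sqrt_pow2; lra.
Qed.

Lemma momentum_small (s e : R) : 0 < s -> 0 < e ->
  exists t, 0 < t < s /\ momentum t < e.
Proof.
  intros hs he. assert (hm := momentum_pos s hs).
  destruct (momentum_surj (Rmin e (momentum s) / 2)) as [t [ht et]].
  { assert (0 < Rmin e (momentum s)) by (apply Rmin_glb_lt; lra). lra. }
  pose proof (Rmin_l e (momentum s)). pose proof (Rmin_r e (momentum s)).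
  exists t. repeat split; [exact ht| |lra].
  apply Rnot_le_lt; intros h. apply momentum_le in h. lra.
Qed.

Lemma phase_small (s e : R) : 0 < s -> 0 < e -> exists t, 0 < t < s /\ phase t < e.
Proof.
  intros hs he. destruct (momentum_small s e hs he) as [t [ht h]].
  exists t; split; [exact ht|].
  assert (h1 := momentum_pos t ltac:(lra)).
  assert (h2 := atan_increasing _ _ h1). rewrite atan_0 in h2. unfold phase; lra.
Qed.

Lemma phase_IVT (a b y : R) : 0 < a -> a < b -> phase a < y -> y < phase b ->
  exists c, a < c < b /\ phase c = y.
Proof.
  intros ha hab h1 h2.
  destruct (IVT_interv (fun t => phase t - y) a b) as [c [hc e]]; [|exact hab|lra|lra|].
  { intros t ht. apply is_derive_continuity_pt with (momentum t).
    assert (h := is_derive_phase t ltac:(lra)).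
    auto_derive; [repeat split; eexists; apply h|].
    rewrite (is_derive_unique (fun x : R => phase x) _ _ h). ring. }
  exists c; split; [|lra].
  assert (c <> a) by (intros ->; lra). assert (c <> b) by (intros ->; lra). lra.
Qed.

Definition nat_floor (x : R) : nat := Z.to_nat (Int_part x).

Lemma nat_floor_spec (x : R) : 0 <= x -> INR (nat_floor x) <= x < INR (nat_floor x) + 1.
Proof.
  intros hx. destruct (base_Int_part x) as [h1 h2].
  assert (h3 : (-1 < Int_part x)%Z) by (apply lt_IZR; simpl; lra).
  unfold nat_floor. rewrite INR_IZR_INZ, Z2Nat.id by lia. lra.
Qed.

(** In units of [PI / nu] the shifted phases of distinct zeros differ by at least 1. Their integer
    parts are therefore distinct and lie between 0 and that of [X s]. *)
Lemma bessel_zero_count_le (nu rho s : R) (g g1 : R -> R) (zs : list R) :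
  bessel_ode nu g g1 -> 0 < rho -> wkb_error rho < nu ^ 2 * (exp (2 * rho) - 1) ->
  NoDup zs -> (forall z, In z zs -> 0 <= z <= s /\ g z = 0) -> 0 <= s ->
  INR (length zs) <= nu * phase (s + rho) / PI + 1.
Proof.
  intros ode hrho hbig hnd hzs hs.
  assert (hn := ode_order _ _ _ ode). assert (hpi := PI_RGT_0).
  set (X := fun z => nu * phase (z + rho) / PI).
  assert (hX : forall z, 0 <= X z).
  { intros z. apply Rmult_le_pos; [|left; apply Rinv_0_lt_compat, hpi].
    apply Rmult_le_pos; [lra|apply phase_nonneg]. }
  set (f := fun z => nat_floor (X z)).
  assert (hgap : forall a b, In a zs -> In b zs -> a < b -> X a + 1 <= X b).
  { intros a b ia ib hab. destruct (hzs a ia) as [ha ea]. destruct (hzs b ib) as [hb eb].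
    assert (h := bessel_zero_gap nu rho g g1 a b ode hrho hbig ltac:(lra) hab ea eb).
    apply Rmult_le_compat_l with (r := nu / PI) in h.
    2:{ left; apply Rdiv_lt_0_compat; lra. }
    replace (nu / PI * (PI / nu)) with 1 in h by (field; lra).
    unfold X. unfold Rdiv in *. lra. }
  assert (hneq : forall a b, In a zs -> In b zs -> a < b -> f a <> f b).
  { intros a b ia ib hab e. assert (h := hgap a b ia ib hab).
    destruct (nat_floor_spec (X a) (hX a)) as [_ h1].
    destruct (nat_floor_spec (X b) (hX b)) as [h2 h3].
    unfold f in e. rewrite e in h1.
    destruct (nat_floor_spec (X a) (hX a)) as [h4 _]. rewrite e in h4. lra. }
  assert (hlen : (length (map f zs) <= length (seq 0 (S (nat_floor (X s)))))%nat).
  { apply NoDup_incl_length.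
    - apply NoDup_map_NoDup_ForallPairs; [|exact hnd].
      intros a b ia ib e. destruct (Rtotal_order a b) as [h|[h|h]]; [|exact h|].
      + exfalso; exact (hneq a b ia ib h e).
      + exfalso; exact (hneq b a ib ia h (eq_sym e)).
    - intros i hi. apply in_map_iff in hi. destruct hi as [z [ez iz]].
      destruct (hzs z iz) as [hz _].
      apply in_seq. split; [lia|]. apply INR_lt.
      destruct (nat_floor_spec (X z) (hX z)) as [h1 _].
      destruct (nat_floor_spec (X s) (hX s)) as [_ h2].
      fold (f z) in h1. rewrite ez in h1.
      assert (X z <= X s).
      { unfold X, Rdiv. apply Rmult_le_compat_r; [left; apply Rinv_0_lt_compat, hpi|].
        apply Rmult_le_compat_l; [lra|apply phase_le; lra]. }
      rewrite plus_INR, S_INR. simpl. lra. }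
  rewrite length_map, length_seq in hlen.
  apply le_INR in hlen. rewrite S_INR in hlen.
  destruct (nat_floor_spec (X s) (hX s)) as [h1 _]. fold (X s). lra.
Qed.

Lemma bessel_zero_count_ge (nu s : R) (g g1 : R -> R) (K : nat) :
  bessel_ode nu g g1 -> forall tau, 0 < tau < s ->
  INR K * (PI / nu) < phase s - phase tau ->
  exists zs, NoDup zs /\ length zs = K /\
    forall z, In z zs -> tau <= z < s /\ g z = 0.
Proof.
  intros ode. assert (hn := ode_order _ _ _ ode).
  assert (hL : 0 < PI / nu) by (apply Rdiv_lt_0_compat; [apply PI_RGT_0|exact hn]).
  induction K as [|K IH]; intros tau htau hK.
  { exists nil; repeat split; [constructor|destruct H|destruct H|destruct H]. }
  rewrite S_INR in hK. assert (hK0 := pos_INR K).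
  assert (hKL : 0 <= INR K * (PI / nu)) by (apply Rmult_le_pos; lra).
  destruct (phase_IVT tau s (phase tau + PI / nu)) as [c0 [hc0 e0]]; try lra.
  (* The next search starts strictly beyond [c0], so that a zero at [c0] is not counted twice. It
     spends half of the spare phase and keeps the inequality strict. *)
  destruct (phase_IVT c0 s (phase c0 + (phase s - phase tau - (INR K + 1) * (PI / nu)) / 2))
    as [c [hc e]]; try lra.
  destruct (IH c) as [zs [hnd [hlen hzs]]]; [lra|lra|].
  destruct (bessel_zero_exists nu g g1 tau c0 ode) as [z [hz ez]]; try lra.
  exists (z :: zs); repeat split.
  - constructor; [|exact hnd]. intros hin. apply hzs in hin. lra.
  - simpl; lia.
  - destruct H as [<-|h]; [lra|]. apply hzs in h; lra.
  - destruct H as [<-|h]; [lra|]. apply hzs in h; lra.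
  - destruct H as [<-|h]; [exact ez|]. apply hzs in h; tauto.
Qed.

Lemma besselJ_zero_gt_order (nu j : R) : 0 < nu -> 0 < j -> besselJ nu j = 0 -> 0 < ln (j / nu).
Proof.
  intros hn hj e. apply Rnot_le_lt; intros h.
  destruct (besselJ_bessel_ode nu hn) as [g1 ode].
  apply (bessel_neq0_left _ _ _ ode _ h). cbv beta.
  rewrite exp_ln by (apply Rdiv_lt_0_compat; lra).
  replace (nu * (j / nu)) with j by (field; lra). exact e.
Qed.

Lemma ln_ratio_lt (nu x y : R) : 0 < nu -> 0 < x -> x < y -> ln (x / nu) < ln (y / nu).
Proof.
  intros hn hx hxy. apply ln_increasing; [apply Rdiv_lt_0_compat; lra|].
  apply Rmult_lt_compat_r; [apply Rinv_0_lt_compat; lra|exact hxy].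
Qed.

(** The [k - 1] smaller zeros together with [j] give [k] zeros to count. The extra [PI / nu] is the
    [+ 1] of the counting bound. *)
Lemma kth_zero_phase_lower (nu rho j : R) (k : nat) : 0 < nu ->
  is_kth_pos_zero (besselJ nu) k j ->
  0 < rho -> wkb_error rho < nu ^ 2 * (exp (2 * rho) - 1) ->
  INR k * (PI / nu) <= phase (ln (j / nu) + rho) + PI / nu.
Proof.
  intros hn [hk [hj [ej [zs [hlen [hnd hzs]]]]]] hrho hbig.
  destruct (besselJ_bessel_ode nu hn) as [g1 ode]. assert (hpi := PI_RGT_0).
  set (f := fun z => ln (z / nu)).
  assert (hin : forall z, In z (j :: zs) -> 0 < z <= j /\ besselJ nu z = 0).
  { intros z [<-|h]; [lra|]. apply hzs in h. lra. }
  assert (hlt : forall a b, In a (j :: zs) -> In b (j :: zs) -> a < b -> f a < f b).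
  { intros a b ia ib hab. apply ln_ratio_lt; [exact hn|apply hin, ia|exact hab]. }
  assert (h := bessel_zero_count_le nu rho (f j) _ g1 (map f (j :: zs)) ode hrho hbig).
  rewrite length_map in h. simpl length in h. rewrite hlen in h.
  replace (S (k - 1)) with k in h by lia.
  apply Rmult_le_reg_r with (nu / PI); [apply Rdiv_lt_0_compat; lra|].
  replace (INR k * (PI / nu) * (nu / PI)) with (INR k) by (field; lra).
  replace ((phase (ln (j / nu) + rho) + PI / nu) * (nu / PI))
    with (nu * phase (f j + rho) / PI + 1) by (unfold f; field; lra).
  apply h.
  - apply NoDup_map_NoDup_ForallPairs.
    + intros a b ia ib e. destruct (Rtotal_order a b) as [hl|[hl|hl]]; [|exact hl|].
      * specialize (hlt a b ia ib hl); lra.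
      * specialize (hlt b a ib ia hl); lra.
    + constructor; [|exact hnd]. intros hi; apply hzs in hi; lra.
  - intros t ht. apply in_map_iff in ht. destruct ht as [z [<- hz]].
    destruct (hin z hz) as [h1 h2]. repeat split.
    + left; apply besselJ_zero_gt_order; [exact hn|lra|exact h2].
    + destruct (proj2 h1) as [hl| ->]; [|apply Rle_refl].
      left; apply hlt; [exact hz|left; reflexivity|exact hl].
    + unfold f. rewrite exp_ln by (apply Rdiv_lt_0_compat; lra).
      replace (nu * (z / nu)) with z by (field; lra). exact h2.
  - left; apply besselJ_zero_gt_order; assumption.
Qed.

(** A larger phase would produce [k] zeros strictly below [j], where there are only [k - 1]. *)
Lemma kth_zero_phase_upper (nu tau j : R) (k : nat) : 0 < nu ->
  is_kth_pos_zero (besselJ nu) k j -> 0 < tau < ln (j / nu) ->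
  phase (ln (j / nu)) - phase tau <= INR k * (PI / nu).
Proof.
  intros hn [hk [hj [ej [zs [hlen [hnd hzs]]]]]] htau.
  destruct (besselJ_bessel_ode nu hn) as [g1 ode].
  apply Rnot_lt_le; intros hlt.
  destruct (bessel_zero_count_ge nu _ _ g1 k ode tau htau hlt) as [ts [hnt [hlt' hts]]].
  assert (hle : (length (map (fun t => (nu * exp t)%R) ts) <= length zs)%nat).
  { apply NoDup_incl_length.
    - apply NoDup_map_NoDup_ForallPairs; [|exact hnt].
      intros a b _ _ e. apply exp_inv. apply Rmult_eq_reg_l with nu; lra.
    - intros z hz. apply in_map_iff in hz. destruct hz as [t [<- it]].
      destruct (hts t it) as [h1 h2]. apply hzs. repeat split.
      + apply Rmult_lt_0_compat; [exact hn|apply exp_pos].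
      + replace j with (nu * exp (ln (j / nu))).
        2:{ rewrite exp_ln by (apply Rdiv_lt_0_compat; lra). field; lra. }
        apply Rmult_lt_compat_l; [exact hn|apply exp_increasing; lra].
      + exact h2. }
  rewrite length_map in hle. lia.
Qed.

(** * Concentration along rays *)

(** The weight [e^(-a t)], with [a = d/2 - 1], is the radial factor [r^(1-d/2)] up to a constant. It
    grows to the left, so the decay rate has to beat it. *)
Lemma bessel_left_small (a delta eta : R) : 0 <= a -> 0 < delta -> 0 < eta ->
  exists N, forall nu g g1, N <= nu -> bessel_ode nu g g1 ->
  forall t, t <= - (2 * delta) ->
  exp (- a * t) * Rabs (g t) <= eta * (exp (- a * - delta) * Rabs (g (- delta))).
Proof.
  intros ha hdl heta.
  assert (hE : 0 < 1 - exp (2 * - delta)).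
  { assert (exp (2 * - delta) < exp 0) by (apply exp_increasing; lra).
    rewrite exp_0 in *. lra. }
  set (s := sqrt (1 - exp (2 * - delta))).
  assert (hs : 0 < s) by (apply sqrt_lt_R0, hE).
  (* Makes [mu - a >= |ln eta| / delta]. Over a distance of at least [delta] this yields the factor
     [eta]. *)
  exists ((a + Rabs (ln eta) / delta) / s).
  intros nu g g1 hN ode t ht.
  assert (h := bessel_left_decay nu g g1 ode delta t hdl ltac:(lra)). fold s in h.
  set (mu := nu * s) in *.
  assert (hmu : a + Rabs (ln eta) / delta <= mu).
  { apply Rmult_le_compat_r with (r := s) in hN; [|lra].
    replace ((a + Rabs (ln eta) / delta) / s * s) with (a + Rabs (ln eta) / delta) in hN
      by (field; lra). exact hN. }
  assert (hab : Rabs (g t) <= Rabs (g (- delta)) * exp (mu * (t + delta))).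
  { rewrite <- (Rabs_pos_eq (exp (mu * (t + delta)))) by (left; apply exp_pos).
    rewrite <- Rabs_mult. apply Rsqr_le_abs_0. unfold Rsqr.
    replace (g (- delta) * exp (mu * (t + delta)) * (g (- delta) * exp (mu * (t + delta))))
      with (g (- delta) ^ 2 * (exp (mu * (t + delta)) * exp (mu * (t + delta)))) by ring.
    rewrite <- exp_plus.
    replace (mu * (t + delta) + mu * (t + delta)) with (2 * mu * (t + delta)) by ring.
    simpl in *. lra. }
  apply Rle_trans with
    (exp (- a * t) * (Rabs (g (- delta)) * exp (mu * (t + delta)))).
  { apply Rmult_le_compat_l; [left; apply exp_pos|exact hab]. }
  replace (exp (- a * t) * (Rabs (g (- delta)) * exp (mu * (t + delta))))
    with (exp ((mu - a) * (t + delta)) * (exp (- a * - delta) * Rabs (g (- delta)))).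
  2:{ rewrite <- Rmult_assoc, <- exp_plus.
      replace ((mu - a) * (t + delta) + - a * - delta) with (- a * t + mu * (t + delta)) by ring.
      rewrite exp_plus. ring. }
  apply Rmult_le_compat_r.
  { apply Rmult_le_pos; [left; apply exp_pos|apply Rabs_pos]. }
  rewrite <- (exp_ln eta) by exact heta. apply exp_le_compat.
  assert (hq : Rabs (ln eta) / delta * delta = Rabs (ln eta)) by (field; lra).
  assert (hq0 : 0 <= Rabs (ln eta) / delta).
  { apply Rmult_le_pos; [apply Rabs_pos|left; apply Rinv_0_lt_compat, hdl]. }
  assert (h1 : - Rabs (ln eta) <= ln eta).
  { pose proof (Rle_abs (- ln eta)) as h1. rewrite Rabs_Ropp in h1. lra. }
  assert (Rabs (ln eta) / delta * delta <= (mu - a) * - (t + delta)).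
  { apply Rmult_le_compat; lra. }
  lra.
Qed.

Lemma bessel_right_small (delta eta : R) : 0 < delta -> 0 < eta ->
  exists N, forall nu g g1, N <= nu -> bessel_ode nu g g1 ->
  exists t1, 0 < t1 < delta /\ forall t, delta <= t -> Rabs (g t) <= eta * Rabs (g t1).
Proof.
  intros hdl heta. assert (hvd := momentum_pos delta hdl).
  assert (he : 0 < eta ^ 2 * momentum delta / 9).
  { apply Rdiv_lt_0_compat; [|lra]. apply Rmult_lt_0_compat; [apply pow_lt, heta|exact hvd]. }
  (* For [t1 <= t2] this gives [9 v(t1) <= eta^2 v(delta)], where 9 is the constant of
     [bessel_right_decay]. *)
  destruct (momentum_small delta _ hdl he) as [t2 [ht2 hv2]].
  set (tau := t2 / 2). assert (htau : 0 < tau < t2) by (unfold tau; lra).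
  assert (hph := phase_lt tau t2 (proj1 htau) (proj2 htau)).
  set (b := (1 + momentum tau ^ 2) / momentum tau ^ 3).
  assert (hpi := PI_RGT_0).
  (* The first bound is the smallness condition of the invariant at [tau]. The second places two
     zeros in [[tau, t2)], the [+ 1] giving strictness. *)
  exists (Rmax b (2 * PI / (phase t2 - phase tau) + 1)).
  intros nu g g1 hN ode. assert (hn := ode_order _ _ _ ode).
  assert (hN1 := Rle_trans _ _ _ (Rmax_l _ _) hN).
  assert (hN2 := Rle_trans _ _ _ (Rmax_r _ _) hN).
  destruct (bessel_zero_count_ge nu t2 g g1 2 ode tau htau) as [zs [hnd [hlen hzs]]].
  { simpl. apply Rmult_lt_reg_r with nu; [exact hn|].
    replace ((1 + 1) * (PI / nu) * nu) with (2 * PI) by (field; lra).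
    replace (2 * PI) with (2 * PI / (phase t2 - phase tau) * (phase t2 - phase tau))
      by (field; lra).
    rewrite (Rmult_comm (phase t2 - phase tau)). apply Rmult_lt_compat_r; lra. }
  assert (hcrit : exists t1, tau <= t1 <= t2 /\ g1 t1 = 0).
  { assert (hR : forall p q, tau <= p < t2 -> tau <= q < t2 -> g p = 0 -> g q = 0 -> p < q ->
      exists t1, tau <= t1 <= t2 /\ g1 t1 = 0).
    { intros p q hp hq ep eq hpq.
      destruct (is_derive_MVT g g1 p q hpq) as [c [hc e]]; [intros; apply (ode_derive _ _ _ ode)|].
      exists c; split; [lra|]. apply Rmult_eq_reg_r with (q - p); lra. }
    destruct zs as [|p [|q [|]]]; try discriminate hlen.
    destruct (hzs p) as [hp ep]; [left; reflexivity|].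
    destruct (hzs q) as [hq eq]; [right; left; reflexivity|].
    destruct (Rtotal_order p q) as [h|[h|h]].
    - exact (hR p q hp hq ep eq h).
    - exfalso. inversion hnd as [|x y hni]. apply hni. left; symmetry; exact h.
    - exact (hR q p hq hp eq ep h). }
  destruct hcrit as [t1 [ht1 e1]].
  exists t1; split; [lra|]. intros t ht.
  assert (h := bessel_right_decay nu g g1 tau t1 t ode (proj1 htau) (proj1 ht1) ltac:(lra) e1 hN1).
  assert (h1 := momentum_le t1 t2 (proj2 ht1)). assert (h2 := momentum_le delta t ht).
  assert (hg := pow2_ge_0 (g t1)).
  assert (h3 : momentum t * g t ^ 2 <= momentum t * (eta ^ 2 * g t1 ^ 2)).
  { eapply Rle_trans; [exact h|].
    apply Rle_trans with (eta ^ 2 * momentum delta * g t1 ^ 2).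
    - rewrite <- Rmult_assoc. apply Rmult_le_compat_r; lra.
    - assert (0 <= (momentum t - momentum delta) * (eta ^ 2 * g t1 ^ 2)).
      { apply Rmult_le_pos; [lra|]. apply Rmult_le_pos; [apply pow2_ge_0|lra]. }
      lra. }
  apply Rmult_le_reg_l in h3; [|lra].
  rewrite <- (Rabs_pos_eq eta), <- Rabs_mult by lra.
  apply Rsqr_le_abs_0. unfold Rsqr. simpl in h3. lra.
Qed.

(** [sup_abs] is an [epsilon], so boundedness must be proved before it means anything. This covers
    the compact range; the left tail comes from [bessel_left_small]. *)
Lemma bessel_weighted_bounded (nu a T0 T : R) (g g1 : R -> R) : bessel_ode nu g g1 -> T0 <= T ->
  exists B, forall t, T0 <= t <= T -> exp (- a * t) * Rabs (g t) <= B.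
Proof.
  intros ode hT.
  destruct (continuity_ab_maj (fun t => (exp (- a * t) * g t) ^ 2) T0 T hT) as [m [hm _]].
  { intros t _. assert (h := ode_derive _ _ _ ode t).
    eapply is_derive_continuity_pt. auto_derive; [repeat split; eexists; apply h|reflexivity]. }
  exists (Rabs (exp (- a * m) * g m)); intros t ht.
  rewrite <- (Rabs_pos_eq (exp (- a * t))) by (left; apply exp_pos).
  rewrite <- Rabs_mult. apply Rsqr_le_abs_0. unfold Rsqr.
  specialize (hm t ht). simpl in hm. lra.
Qed.

(** * Boundedness of spherical harmonics, comparison of suprema, and motion along rays *)

Lemma sumR_nonneg (n : nat) (f : nat -> R) : (forall i, 0 <= f i) -> 0 <= sumR n f.
Proof.
  intros hf; induction n as [|n IH]; simpl; [lra|]. specialize (hf n); lra.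
Qed.

Lemma sumR_ge_term (n i : nat) (f : nat -> R) :
  (forall i, 0 <= f i) -> (i < n)%nat -> f i <= sumR n f.
Proof.
  intros hf; induction n as [|n IH]; intros hi; [lia|]. simpl.
  destruct (Nat.eq_dec i n) as [->|hne].
  - pose proof (sumR_nonneg n f hf); lra.
  - specialize (IH ltac:(lia)). specialize (hf n). lra.
Qed.

Lemma sumR_mult_l (n : nat) (a : R) (f : nat -> R) :
  sumR n (fun i => a * f i) = a * sumR n f.
Proof. induction n as [|n IH]; simpl; [ring|]. rewrite IH; ring. Qed.

Lemma vnorm_vscale (d : nat) (a : R) (x : Rvec) : 0 <= a ->
  vnorm d (vscale a x) = a * vnorm d x.
Proof.
  intros ha; unfold vnorm, vscale.
  replace (fun i => (a * x i) ^ 2) with (fun i => a ^ 2 * x i ^ 2)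
    by (apply functional_extensionality; intros i; ring).
  rewrite sumR_mult_l, sqrt_mult_alt by apply pow2_ge_0.
  rewrite sqrt_pow2 by exact ha. reflexivity.
Qed.

Lemma vnorm_coord_le (d i : nat) (x : Rvec) : (i < d)%nat -> Rabs (x i) <= vnorm d x.
Proof.
  intros hi; unfold vnorm. rewrite <- sqrt_Rsqr_abs. apply sqrt_le_1_alt.
  replace (Rsqr (x i)) with ((fun i => x i ^ 2) i) by (unfold Rsqr; ring).
  apply (sumR_ge_term d i (fun i => x i ^ 2)); [intros; apply pow2_ge_0|exact hi].
Qed.

Lemma mono_eval_bounded (d : nat) (x : Rvec) (a : list nat) (i : nat) :
  vnorm d x = 1 -> (i + length a <= d)%nat -> Rabs (mono_eval x i a) <= 1.
Proof.
  intros hx; revert i; induction a as [|e a IH]; intros i hi; simpl in *.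
  - rewrite Rabs_R1; lra.
  - rewrite Rabs_mult, <- RPow_abs. rewrite <- (Rmult_1_l 1).
    apply Rmult_le_compat; [apply pow_le, Rabs_pos|apply Rabs_pos| |apply IH; lia].
    rewrite <- (pow1 e). apply pow_incr. split; [apply Rabs_pos|].
    rewrite <- hx. apply vnorm_coord_le; lia.
Qed.

Lemma spherical_harmonic_bounded (d l : nat) (Y : Rvec -> R) : spherical_harmonic d l Y ->
  exists B, 0 <= B /\ forall x, vnorm d x = 1 -> Rabs (Y x) <= B.
Proof.
  intros [p [[hp _] hY]].
  assert (h : exists B, 0 <= B /\ forall x, vnorm d x = 1 -> Rabs (poly_eval p x) <= B).
  { clear hY Y. induction hp as [|t p [ht _] _ [B [hB IH]]].
    - exists 0; split; [lra|]. intros x _. simpl. rewrite Rabs_R0; lra.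
    - exists (Rabs (fst t) + B); split; [pose proof (Rabs_pos (fst t)); lra|].
      intros x hx. simpl. eapply Rle_trans; [apply Rabs_triang|].
      apply Rplus_le_compat; [|apply IH, hx].
      rewrite Rabs_mult. rewrite <- (Rmult_1_r (Rabs (fst t))) at 2.
      apply Rmult_le_compat_l; [apply Rabs_pos|].
      apply mono_eval_bounded with d; [exact hx|lia]. }
  destruct h as [B [hB h]]. exists B; split; [exact hB|].
  intros x hx; rewrite hY by exact hx. apply h, hx.
Qed.

Lemma sup_abs_is_lub (D : Rvec -> Prop) (f : Rvec -> R) (B : R) :
  (forall x, D x -> Rabs (f x) <= B) ->
  is_lub (fun y => y = 0 \/ exists x, D x /\ y = Rabs (f x)) (sup_abs D f).
Proof.
  intros hB. unfold sup_abs. apply epsilon_spec.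
  destruct (completeness (fun y => y = 0 \/ exists x, D x /\ y = Rabs (f x))) as [m hm].
  - exists (Rmax 0 B). intros y [->|[x [hx ->]]]; [apply Rmax_l|].
    eapply Rle_trans; [apply hB, hx|apply Rmax_r].
  - exists 0; left; reflexivity.
  - exists m; exact hm.
Qed.

Lemma sup_abs_ratio_le (D D' : Rvec -> Prop) (f : Rvec -> R) (B eta : R) : 0 <= eta ->
  (forall x, D' x -> Rabs (f x) <= B) -> (forall x, D x -> D' x) ->
  (forall x, D x -> exists x', D' x' /\ Rabs (f x) <= eta * Rabs (f x')) ->
  0 <= sup_abs D f / sup_abs D' f <= eta.
Proof.
  intros heta hB hsub hcmp.
  destruct (sup_abs_is_lub D' f B hB) as [u' _].
  destruct (sup_abs_is_lub D f B) as [u l]; [intros x hx; apply hB, hsub, hx|].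
  assert (h0 : 0 <= sup_abs D f) by (apply u; left; reflexivity).
  assert (h0' : 0 <= sup_abs D' f) by (apply u'; left; reflexivity).
  assert (hle : sup_abs D f <= eta * sup_abs D' f).
  { apply l. intros y [->|[x [hx ->]]]; [apply Rmult_le_pos; lra|].
    destruct (hcmp x hx) as [x' [hx' h]].
    eapply Rle_trans; [exact h|]. apply Rmult_le_compat_l; [exact heta|].
    apply u'. right; exists x'; split; [exact hx'|reflexivity]. }
  destruct h0' as [h|h].
  - split; [apply Rmult_le_pos; [exact h0|left; apply Rinv_0_lt_compat, h]|].
    apply Rmult_le_reg_r with (sup_abs D' f); [exact h|].
    unfold Rdiv; rewrite Rmult_assoc, Rinv_l, Rmult_1_r by lra. exact hle.
  (* A zero denominator forces a zero numerator, and the quotient is then [0] by the convention for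
     division. *)
  - rewrite <- h in *. assert (e : sup_abs D f = 0) by lra. rewrite e.
    unfold Rdiv; rewrite Rmult_0_l; lra.
Qed.

(** In the variable [t = ln (j r / nu)] the unit sphere sits at [T], and [r^(1-d/2)] splits into a
    constant and the weight. *)
Lemma u_eig_radial (d l : nat) (c j : R) (Y : Rvec -> R) (x : Rvec) :
  0 < nu d c l -> 0 < j -> 0 < vnorm d x ->
  let T := ln (j / nu d c l) in
  let t := T + ln (vnorm d x) in
  Rabs (u_eig d c l j Y x) =
  exp ((INR d / 2 - 1) * T) *
  (exp (- (INR d / 2 - 1) * t) * Rabs (besselJ (nu d c l) (nu d c l * exp t))) *
  Rabs (Y (vscale (/ vnorm d x) x)).
Proof.
  intros hn hj hx T t; unfold u_eig.
  rewrite !Rabs_mult. f_equal. rewrite <- Rmult_assoc, <- exp_plus. f_equal.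
  - unfold Rpower. rewrite Rabs_pos_eq by (left; apply exp_pos).
    f_equal. unfold t. ring.
  - f_equal. f_equal. unfold t, T. rewrite exp_plus, !exp_ln.
    + field; lra.
    + exact hx.
    + apply Rdiv_lt_0_compat; lra.
Qed.

(* Moving radially to [log (j r' / nu) = t'] keeps the angular factor. *)
Lemma u_eig_radial_move (d l : nat) (c j : R) (Y : Rvec -> R) (x : Rvec) (t' : R) :
  0 < nu d c l -> 0 < j -> 0 < vnorm d x ->
  let T := ln (j / nu d c l) in
  t' < T ->
  exists x', ball_set d x' /\
  Rabs (u_eig d c l j Y x') =
  exp ((INR d / 2 - 1) * T) *
  (exp (- (INR d / 2 - 1) * t') * Rabs (besselJ (nu d c l) (nu d c l * exp t'))) *
  Rabs (Y (vscale (/ vnorm d x) x)).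
Proof.
  intros hn hj hx T ht'.
  set (r' := exp (t' - T)). assert (hr' : 0 < r') by apply exp_pos.
  set (x' := vscale (r' / vnorm d x) x).
  assert (hx' : vnorm d x' = r').
  { unfold x'. rewrite vnorm_vscale; [field; lra|]. left; apply Rdiv_lt_0_compat; lra. }
  exists x'; split.
  - unfold ball_set. rewrite hx'. split; [exact hr'|].
    rewrite <- exp_0. apply exp_increasing; lra.
  - rewrite u_eig_radial by (rewrite ?hx'; assumption).
    fold T. rewrite hx'. unfold r' at 1 2. rewrite ln_exp.
    replace (T + (t' - T)) with t' by ring.
    f_equal. f_equal. f_equal. apply functional_extensionality; intros i.
    unfold vscale, x', vscale. field. lra.
Qed.

(** * Limit of the zeros and conclusion *)

(** Turns the equation defining [h(w)] into [phase (ln h) = PI / w], through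
    [acos (1/h) = atan (sqrt (h^2 - 1))]. *)
Lemma phase_ln (h : R) : 1 < h -> phase (ln h) = sqrt (h ^ 2 - 1) - acos (/ h).
Proof.
  intros hh. assert (hi : 0 < / h) by (apply Rinv_0_lt_compat; lra).
  assert (em : momentum (ln h) = sqrt (h ^ 2 - 1)).
  { unfold momentum. replace (2 * ln h) with (ln h + ln h) by ring.
    rewrite exp_plus, exp_ln by lra. f_equal; ring. }
  unfold phase. rewrite em, acos_atan by exact hi.
  cut (sqrt (h ^ 2 - 1) = sqrt (1 - Rsqr (/ h)) / / h); [intros <-; reflexivity|].
  replace (h ^ 2 - 1) with (h ^ 2 * (1 - Rsqr (/ h))) by (unfold Rsqr; field; lra).
  rewrite sqrt_mult_alt, sqrt_pow2 by (try apply pow2_ge_0; lra). field. lra.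
Qed.

Lemma nu_bounds (d l : nat) (c : R) : (2 <= d)%nat -> 0 <= c ->
  INR l <= nu d c l <= INR l + (INR d / 2 - 1 + c).
Proof.
  intros hd hc. apply le_INR in hd. simpl in hd. pose proof (pos_INR l).
  unfold nu. set (p := INR l + INR d / 2 - 1). assert (hp : INR l <= p) by (unfold p; lra).
  split.
  - apply Rle_trans with p; [exact hp|].
    rewrite <- (sqrt_pow2 p) at 1 by lra. apply sqrt_le_1_alt.
    pose proof (pow2_ge_0 c); lra.
  - replace (INR l + (INR d / 2 - 1 + c)) with (p + c) by (unfold p; ring).
    rewrite <- (sqrt_pow2 (p + c)) by lra. apply sqrt_le_1_alt. nra.
Qed.

Lemma nat_to_infty_lim (s : nat -> nat) : nat_to_infty s ->
  is_lim_seq (fun n => INR (s n)) p_infty.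
Proof.
  intros hs. apply is_lim_seq_spec. intros M.
  destruct (nfloor_ex (Rmax 0 M)) as [m hm]; [apply Rmax_l|].
  destruct (hs (S m)) as [N hN]. exists N; intros n hn.
  apply Rlt_le_trans with (INR (S m)); [|apply le_INR, hN, hn].
  rewrite S_INR. pose proof (Rmax_r 0 M). lra.
Qed.

Section ZeroLimit.
Variables (d : nat) (c w : R) (k l : nat -> nat) (j : nat -> R).
Hypotheses (hd : (2 <= d)%nat) (hc : 0 <= c) (hw : 0 < w).
Hypotheses (hk : nat_to_infty k) (hl : nat_to_infty l).
Hypothesis hlk : Un_cv (fun n => INR (l n) / INR (k n)) w.
Hypothesis hj : forall n, is_kth_pos_zero (besselJ (nu d c (l n))) (k n) (j n).

Lemma nu_lim : is_lim_seq (fun n => nu d c (l n)) p_infty.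
Proof.
  apply is_lim_seq_le_p_loc with (fun n => INR (l n)).
  - exists 0%nat; intros n _. apply nu_bounds; assumption.
  - apply nat_to_infty_lim, hl.
Qed.

Lemma nu_eventually_gt (M : R) : eventually (fun n => M < nu d c (l n)).
Proof. assert (h := nu_lim). apply is_lim_seq_spec in h. exact (h M). Qed.

Let hk0 (n : nat) : 0 < INR (k n).
Proof. destruct (hj n) as [h _]. apply lt_0_INR. lia. Qed.

(** [nu_l - l] is bounded, so [l / k -> w] passes to [nu_l / k]. *)
Lemma kth_phase_lim : is_lim_seq (fun n => INR (k n) * (PI / nu d c (l n))) (PI / w).
Proof.
  assert (hpi := PI_RGT_0).
  assert (h1 : is_lim_seq (fun n => nu d c (l n) / INR (k n)) w).
  { set (e := INR d / 2 - 1 + c).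
    apply is_lim_seq_le_le with (fun n => INR (l n) / INR (k n))
      (fun n => INR (l n) / INR (k n) + e * / INR (k n)).
    - intros n. destruct (nu_bounds d (l n) c hd hc) as [a b]. fold e in b.
      assert (hi := Rinv_0_lt_compat _ (hk0 n)). unfold Rdiv. nra.
    - apply is_lim_seq_Reals, hlk.
    - replace (Finite w) with (Finite (w + e * 0)) by (f_equal; ring).
      apply is_lim_seq_plus'; [apply is_lim_seq_Reals, hlk|].
      apply is_lim_seq_mult'; [apply is_lim_seq_const|].
      replace (Finite 0) with (Rbar_inv p_infty) by reflexivity.
      apply is_lim_seq_inv; [apply nat_to_infty_lim, hk|discriminate]. }
  apply is_lim_seq_ext_loc with (fun n => PI * / (nu d c (l n) / INR (k n))).
  - destruct (nu_eventually_gt 0) as [N hN]. exists N; intros n hn.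
    specialize (hN n hn). specialize (hk0 n). field; lra.
  - apply is_lim_seq_mult'; [apply is_lim_seq_const|].
    apply (is_lim_seq_inv _ w h1). intros e; injection e; lra.
Qed.

(** Otherwise the shifted phase of the zero is at most [phase (s + rho) = PI / w - g]. But
    [k PI / nu] is within [g/2] of [PI / w], and the counting slack [PI / nu] is below [g/2]. *)
Lemma zero_ratio_gt (S s : R) : phase S = PI / w -> 0 < s < S ->
  eventually (fun n => s < ln (j n / nu d c (l n))).
Proof.
  intros hS hs. assert (hpi := PI_RGT_0).
  set (rho := (S - s) / 2). assert (hrho : 0 < rho) by (unfold rho; lra).
  assert (hq := exp_2_minus_1_pos rho hrho).
  assert (hgap := phase_lt (s + rho) S ltac:(lra) ltac:(unfold rho; lra)).
  set (g := phase S - phase (s + rho)). assert (hg : 0 < g) by (unfold g; lra).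
  assert (h1 := kth_phase_lim). rewrite <- hS in h1. apply is_lim_seq_spec in h1.
  assert (hg2 : 0 < g / 2) by lra. specialize (h1 (mkposreal _ hg2)).
  assert (h2 := nu_eventually_gt (2 * PI / g)).
  (* The [+ 1] makes [nu > 1], so that [nu^2] exceeds the quotient as well. *)
  assert (h3 := nu_eventually_gt (wkb_error rho / (exp (2 * rho) - 1) + 1)).
  generalize (filter_and _ _ h1 (filter_and _ _ h2 h3)). clear h1 h2 h3.
  apply filter_imp. intros n [h1 [h2 h3]]. simpl in h1.
  set (v := nu d c (l n)) in *.
  assert (hwe := wkb_error_pos rho hrho).
  assert (hqq : 0 < wkb_error rho / (exp (2 * rho) - 1)) by (apply Rdiv_lt_0_compat; lra).
  assert (hv : 0 < v) by lra.
  apply Rnot_le_lt; intros hle.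
  assert (hz := kth_zero_phase_lower v rho (j n) (k n) hv (hj n) hrho).
  assert (hbig : wkb_error rho < v ^ 2 * (exp (2 * rho) - 1)).
  { replace (wkb_error rho) with (wkb_error rho / (exp (2 * rho) - 1) * (exp (2 * rho) - 1))
      by (field; lra).
    apply Rmult_lt_compat_r; [exact hq|]. nra. }
  specialize (hz hbig).
  assert (hpos : 0 < ln (j n / v)).
  { destruct (hj n) as [_ [hjn [ejn _]]]. apply besselJ_zero_gt_order; assumption. }
  assert (hmon := phase_le (ln (j n / v) + rho) (s + rho) ltac:(lra) ltac:(lra)).
  apply Rabs_def2 in h1.
  assert (PI / v < g / 2).
  { apply Rmult_lt_reg_r with (v * 2 / g).
    { apply Rdiv_lt_0_compat; lra. }
    replace (PI / v * (v * 2 / g)) with (2 * PI / g) by (field; lra).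
    replace (g / 2 * (v * 2 / g)) with v by (field; lra). exact h2. }
  unfold g in *. lra.
Qed.

Lemma zero_ratio_lt (S s : R) : phase S = PI / w -> 0 < S < s ->
  eventually (fun n => ln (j n / nu d c (l n)) < s).
Proof.
  intros hS hs.
  assert (hgap := phase_lt S s (proj1 hs) (proj2 hs)).
  set (g := phase s - phase S). assert (hg : 0 < g / 2) by (unfold g; lra).
  destruct (phase_small s (g / 2) ltac:(lra) hg) as [tau [htau hph]].
  assert (h1 := kth_phase_lim). rewrite <- hS in h1. apply is_lim_seq_spec in h1.
  specialize (h1 (mkposreal _ hg)).
  assert (h2 := nu_eventually_gt 0).
  generalize (filter_and _ _ h1 h2). clear h1 h2.
  apply filter_imp. intros n [h1 hv]. simpl in h1. apply Rabs_def2 in h1.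
  apply Rnot_le_lt; intros hle.
  assert (hz := kth_zero_phase_upper _ tau (j n) (k n) hv (hj n) ltac:(lra)).
  assert (hmon := phase_le s _ ltac:(lra) hle).
  unfold g in *. lra.
Qed.

End ZeroLimit.

Theorem theorem2p2 (d : nat) (c : R) (hd : (2 <= d)%nat) (hc : 0 <= c)
  (eps w h : R) (heps : 0 < eps) (hw : 0 < w)
  (hh : 1 < h /\ sqrt (h ^ 2 - 1) - acos (/ h) = PI / w)
  (k l : nat -> nat) (j : nat -> R) (Y : nat -> Rvec -> R)
  (hk : nat_to_infty k) (hl : nat_to_infty l)
  (hlk : Un_cv (fun n => INR (l n) / INR (k n)) w)
  (hj : forall n, is_kth_pos_zero (besselJ (nu d c (l n))) (k n) (j n))
  (hY : forall n, spherical_harmonic d (l n) (Y n) /\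
                  exists x, vnorm d x = 1 /\ Y n x <> 0) :
  Un_cv (fun n =>
    sup_abs (D_ball d (/ h) eps) (u_eig d c (l n) (j n) (Y n))
    / sup_abs (ball_set d) (u_eig d c (l n) (j n) (Y n))) 0.
Proof.
  destruct hh as [hh1 hph]. rewrite <- phase_ln in hph by exact hh1.
  set (S := ln h) in *.
  assert (hS : 0 < S) by (unfold S; rewrite <- ln_1; apply ln_increasing; lra).
  assert (hhe : 0 < h * eps) by (apply Rmult_lt_0_compat; lra).
  set (m := ln (1 + h * eps)).
  assert (hm : 0 < m) by (unfold m; rewrite <- ln_1; apply ln_increasing; lra).
  (* Outside the shell [|ln (r h)| >= m >= 4 delta], and [T] is within [delta] of [S], so
     [|T + ln r| >= 3 delta]. The bound by [S] gives [T > 3 delta], which keeps [t1] and [- delta]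
     inside the ball. *)
  set (delta := Rmin m S / 4).
  assert (hdl : 0 < delta).
  { assert (0 < Rmin m S) by (apply Rmin_glb_lt; lra). unfold delta; lra. }
  assert (hdm : 4 * delta <= m) by (unfold delta; pose proof (Rmin_l m S); lra).
  assert (hdS : 4 * delta <= S) by (unfold delta; pose proof (Rmin_r m S); lra).
  set (a := INR d / 2 - 1).
  assert (ha : 0 <= a) by (apply le_INR in hd; simpl in hd; unfold a; lra).
  intros e he. set (eta := e / 2). assert (heta : 0 < eta) by (unfold eta; lra).
  destruct (bessel_left_small a delta eta ha hdl heta) as [N1 hN1].
  destruct (bessel_right_small delta eta hdl heta) as [N2 hN2].
  assert (ev1 := zero_ratio_gt d c w k l j hd hc hw hk hl hlk hj S (S - delta) hph ltac:(lra)).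
  assert (ev2 := zero_ratio_lt d c w k l j hd hc hw hk hl hlk hj S (S + delta) hph ltac:(lra)).
  assert (ev3 := nu_eventually_gt d c l hd hc hl (Rmax 0 (Rmax N1 N2))).
  destruct (filter_and _ _ ev1 (filter_and _ _ ev2 ev3)) as [N hN]. clear ev1 ev2 ev3.
  exists N; intros n hn. destruct (hN n hn) as [hT1 [hT2 hnu]]. clear hN.
  destruct (hj n) as [_ [hjn _]]. destruct (hY n) as [hYn _].
  set (T := ln (j n / nu d c (l n))) in *.
  assert (hv : 0 < nu d c (l n)) by (pose proof (Rmax_l 0 (Rmax N1 N2)); lra).
  assert (hM := Rmax_r 0 (Rmax N1 N2)).
  assert (hv1 : N1 <= nu d c (l n)) by (pose proof (Rmax_l N1 N2); lra).
  assert (hv2 : N2 <= nu d c (l n)) by (pose proof (Rmax_r N1 N2); lra).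
  destruct (besselJ_bessel_ode _ hv) as [g1 ode].
  assert (hleft := hN1 _ _ _ hv1 ode). destruct (hN2 _ _ _ hv2 ode) as [t1 [ht1 hright]].
  clear hN1 hN2. cbv beta in hleft, hright.
  destruct (spherical_harmonic_bounded d (l n) (Y n) hYn) as [BY [hBY hYb]].
  destruct (bessel_weighted_bounded _ a (- (2 * delta)) T _ _ ode ltac:(lra)) as [B1 hB1].
  cbv beta in hB1.
  set (J := fun t => besselJ (nu d c (l n)) (nu d c (l n) * exp t)) in *.
  set (f := fun t => exp (- a * t) * Rabs (J t)).
  change (forall t, t <= - (2 * delta) -> f t <= eta * f (- delta)) in hleft.
  change (forall t, - (2 * delta) <= t <= T -> f t <= B1) in hB1.
  assert (hr2 : forall t, delta <= t -> f t <= eta * f t1).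
  { intros t ht. unfold f.
    apply Rle_trans with (exp (- a * t1) * (eta * Rabs (J t1))); [|right; ring].
    apply Rmult_le_compat; [left; apply exp_pos|apply Rabs_pos| |apply hright, ht].
    apply exp_le_compat. nra. }
  (* Boundedness up to the origin: for [t <= - 2 delta] the left comparison also controls the
     growing weight. *)
  assert (hfb : exists B, 0 <= B /\ forall t, t < T -> f t <= B).
  { exists (Rmax 0 (Rmax B1 (eta * f (- delta)))). split; [apply Rmax_l|].
    intros t ht. eapply Rle_trans; [|apply Rmax_r].
    destruct (Rle_dec t (- (2 * delta))) as [h1|h1].
    - eapply Rle_trans; [apply hleft, h1|apply Rmax_r].
    - eapply Rle_trans; [apply hB1; lra|apply Rmax_l]. }
  destruct hfb as [B [hB hfb]].
  assert (hu : forall x, 0 < vnorm d x ->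
    Rabs (u_eig d c (l n) (j n) (Y n) x) =
    exp (a * T) * f (T + ln (vnorm d x)) * Rabs (Y n (vscale (/ vnorm d x) x)))
    by (intros x hx; exact (u_eig_radial d (l n) c (j n) (Y n) x hv hjn hx)).
  assert (hratio : 0 <=
    sup_abs (D_ball d (/ h) eps) (u_eig d c (l n) (j n) (Y n))
    / sup_abs (ball_set d) (u_eig d c (l n) (j n) (Y n)) <= eta).
  { apply sup_abs_ratio_le with (exp (a * T) * B * BY).
    - lra.
    - intros x [hx hx1]. rewrite hu by exact hx.
      assert (hln : ln (vnorm d x) < 0) by (rewrite <- ln_1; apply ln_increasing; assumption).
      apply Rmult_le_compat.
      + apply Rmult_le_pos; [left; apply exp_pos|].
        apply Rmult_le_pos; [left; apply exp_pos|apply Rabs_pos].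
      + apply Rabs_pos.
      + apply Rmult_le_compat_l; [left; apply exp_pos|apply hfb; lra].
      + apply hYb. rewrite vnorm_vscale; [field; lra|].
        left; apply Rinv_0_lt_compat, hx.
    - intros x [hx _]; exact hx.
    - intros x [[hx hx1] hxD]. rewrite hu by exact hx.
      set (r := vnorm d x) in *.
      assert (hlr : ln r = ln (r * h) - S).
      { unfold S. rewrite ln_mult by lra. ring. }
      (* Inside the shell the comparison point is [- delta], outside it is the critical point [t1].
         Inside, [ln (r h) <= - h eps <= - m] uses the concavity of [ln] twice. *)
      assert (hcase : exists t', t' < T /\ f (T + ln r) <= eta * f t').
      { unfold Rabs in hxD. destruct (Rcase_abs (r - / h)) as [hneg|hpos].
        - exists (- delta); split; [lra|]. apply hleft.
          assert (hrh : r * h <= 1 - h * eps).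
          { apply Rle_trans with ((/ h - eps) * h); [apply Rmult_le_compat_r; lra|].
            right; field; lra. }
          assert (hrh0 : 0 < r * h) by (apply Rmult_lt_0_compat; lra).
          assert (h1 : ln (r * h) <= r * h - 1).
          { rewrite <- (ln_exp (r * h - 1)). apply ln_le; [exact hrh0|].
            pose proof (exp_ineq1_le (r * h - 1)); lra. }
          assert (h2 : m <= h * eps).
          { apply Rle_trans with (ln (exp (h * eps))); [|right; apply ln_exp].
            apply ln_le; [lra|apply exp_ineq1_le]. }
          lra.
        - exists t1; split; [lra|]. apply hr2.
          assert (hrh : 1 + h * eps <= r * h).
          { apply Rle_trans with ((/ h + eps) * h); [right; field; lra|].
            apply Rmult_le_compat_r; lra. }
          assert (h1 : m <= ln (r * h)) by (apply ln_le; lra).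
          lra. }
      destruct hcase as [t' [ht' hf]].
      destruct (u_eig_radial_move d (l n) c (j n) (Y n) x t' hv hjn hx ht') as [x' [hx' e']].
      exists x'; split; [exact hx'|]. rewrite e'.
      change (exp (a * T) * f (T + ln r) * Rabs (Y n (vscale (/ r) x)) <=
        eta * (exp (a * T) * f t' * Rabs (Y n (vscale (/ r) x)))).
      rewrite <- Rmult_assoc. apply Rmult_le_compat_r; [apply Rabs_pos|].
      apply Rle_trans with (exp (a * T) * (eta * f t')); [|right; ring].
      apply Rmult_le_compat_l; [left; apply exp_pos|exact hf]. }
  unfold R_dist. rewrite Rminus_0_r, Rabs_pos_eq by lra. unfold eta in hratio; lra.
Qed.
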